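(* Let $k\ge 1$ and let $F_k$ be the free group with a fixed basis $X=\{x_1,\ldots,x_k\}$. Let $H,J\le F_k$ be finitely generated subgroups and assume that the core graph $\Gamma_X(J)$ is a quotient of the core graph $\Gamma_X(H)$. Then $H$ is a free factor of $J$ if and only if $$\rho_X(H,J)=\mathrm{rk}(J)-\mathrm{rk}(H).$$
   Context: A subgroup $H$ of a free group $J$ is a free factor of $J$ if there is $H'\le J$ with $H*H'=J$; $\mathrm{rk}$ denotes the rank of a free group. Core graphs: for $H\le F_k$, the Schreier coset graph has as vertices the right cosets $Hw$, basepoint $H$, and for every coset $Hw$ and every $i$ a directed edge labeled $i$ (an $i$-edge) from $Hw$ to $Hwx_i$. The core graph $\Gamma_X(H)$ is the pointed, directed, edge-labeled subgraph consisting of the basepoint and all vertices and edges traversed by some reduced (non-backtracking) path that starts and ends at the basepoint. It is finite iff $H$ is finitely generated, and $H\mapsto\Gamma_X(H)$ is a bijection between subgroups of $F_k$ and (isomorphism classes of) core graphs. A morphism of core graphs maps vertices to vertices and edges to edges, preserving incidence, basepoint, and directions and labels of edges. A morphism $\Gamma_X(H)\to\Gamma_X(J)$ exists iff $H\le J$, and it is then unique. $\Gamma_X(J)$ is a quotient of $\Gamma_X(H)$ if this morphism exists and is surjective on vertices and on edges. Immediate quotients: let $\Gamma$ be a finite core graph and $u\ne v$ two vertices of $\Gamma$. Identify $u$ with $v$, and then, as long as there are two distinct edges with the same label sharing the same origin (resp. terminus), merge these two edges and their termini (resp. origins). The resulting core graph is called an immediate quotient of $\Gamma$ (generated by merging $u,v$).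 Distance: if $\Gamma_X(J)$ is a quotient of $\Gamma_X(H)$ ($H,J$ finitely generated), $\rho_X(H,J)$ is the smallest $m\ge 0$ for which there are core graphs $\Gamma_0=\Gamma_X(H),\Gamma_1,\ldots,\Gamma_m=\Gamma_X(J)$ with $\Gamma_{i}$ an immediate quotient of $\Gamma_{i-1}$ for each $1\le i\le m$. *)

(* Defs.v *)
From mathcomp Require Export all_boot all_algebra.
From mathcomp Require Export boolp classical_sets functions.
From Stdlib Require Import Relation_Operators.

Set Implicit Arguments.
Unset Strict Implicit.
Unset Printing Implicit Defensive.

Local Open Scope classical_set_scope.
Local Open Scope group_scope.

Section Groups.
Variable F : groupType.

(* A letter (i, b) over a family g stands for g i when b is true and for its
   inverse when b is false. *)
Definition letter_val n (g : 'I_n -> F) (l : 'I_n * bool) : F :=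
  if l.2 then g l.1 else (g l.1)^-1.

Definition word_val n (g : 'I_n -> F) (w : seq ('I_n * bool)) : F :=
  \prod_(l <- w) letter_val g l.

Definition reduced_word n (w : seq ('I_n * bool)) : bool :=
  sorted (fun l l' => l' != (l.1, ~~ l.2)) w.

Definition is_subgroup (H : set F) : Prop :=
  [/\ H 1, forall x y, H x -> H y -> H (x * y) & forall x, H x -> H x^-1].

Definition fin_gen (H : set F) : Prop :=
  exists n (g : 'I_n -> F), H = range (word_val g).

(* Every element of H is the value of exactly one reduced word in b, and all
   these values lie in H. *)
Definition free_basis n (b : 'I_n -> F) (H : set F) : Prop :=
  set_bij [set w | reduced_word w] H (word_val b).

(* The rank is 0 by convention when H is not free of finite rank. *)
Definition rk (H : set F) : nat :=
  xget 0 [set n | exists b : 'I_n -> F, free_basis b H].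

(* Normal forms of H1 * H2: an entry (true, x) is a syllable from H1, an entry
   (false, x) a syllable from H2. *)
Definition alternating (H1 H2 : set F) (s : seq (bool * F)) : Prop :=
  sorted (fun a a' => a.1 != a'.1) s /\
  {in s, forall a, a.2 != 1 /\ (if a.1 then H1 else H2) a.2}.

(* J is the internal free product of H1 and H2. *)
Definition free_product (H1 H2 J : set F) : Prop :=
  set_bij [set s | alternating H1 H2 s] J (fun s => \prod_(a <- s) a.2).

Definition free_factor (H J : set F) : Prop :=
  exists H' : set F, [/\ is_subgroup H', H' `<=` J & free_product H H' J].

End Groups.

Section Graphs.
Variable k : nat.

(* Pointed directed graphs with edges labelled by 'I_k; loops and parallel edges
   are allowed. *)
Record pgraph := PGraph {
  vert : Type;
  edge : Type;
  org : edge -> vert;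
  ter : edge -> vert;
  lab : edge -> 'I_k;
  base : vert }.

Arguments org {p}.
Arguments ter {p}.
Arguments lab {p}.
Arguments base {p}.

(* A step (e, true) follows e along its direction, (e, false) against it. *)
Definition src (G : pgraph) (d : edge G * bool) : vert G :=
  if d.2 then org d.1 else ter d.1.
Definition tgt (G : pgraph) (d : edge G * bool) : vert G :=
  if d.2 then ter d.1 else org d.1.

Fixpoint walk (G : pgraph) (x : vert G) (p : seq (edge G * bool)) (y : vert G)
    : Prop :=
  if p is d :: p' then src d = x /\ walk (tgt d) p' y else x = y.

Definition reduced_walk (G : pgraph) (p : seq (edge G * bool)) : Prop :=
  forall p1 e b p2, p <> p1 ++ (e, b) :: (e, ~~ b) :: p2.

Definition core_edges (G : pgraph) : set (edge G) :=
  [set e | exists p1 b p2, let p := p1 ++ (e, b) :: p2 in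
    walk base p base /\ reduced_walk p].

Definition core_verts (G : pgraph) : set (vert G) :=
  [set v | v = base \/
    exists e, core_edges e /\ (org e = v \/ ter e = v)].

Lemma core_org (G : pgraph) (e : core_edges (G := G)) :
  org (val e) \in core_verts (G := G).
Proof.
by apply/mem_set; right; exists (val e); split; [exact: set_valP | left].
Qed.

Lemma core_ter (G : pgraph) (e : core_edges (G := G)) :
  ter (val e) \in core_verts (G := G).
Proof.
by apply/mem_set; right; exists (val e); split; [exact: set_valP | right].
Qed.

Lemma core_base (G : pgraph) : base \in core_verts (G := G).
Proof. by apply/mem_set; left. Qed.

Definition core (G : pgraph) : pgraph :=
  @PGraph (core_verts (G := G)) (core_edges (G := G))
    (fun e => SigSub (core_org e)) (fun e => SigSub (core_ter e))
    (fun e => lab (val e)) (SigSub (core_base G)).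

Definition morphism (G G' : pgraph) (fv : vert G -> vert G')
    (fe : edge G -> edge G') : Prop :=
  [/\ fv base = base,
      forall e, org (fe e) = fv (org e),
      forall e, ter (fe e) = fv (ter e) &
      forall e, lab (fe e) = lab e].

Definition surjective_morphism (G G' : pgraph) (fv : vert G -> vert G')
    (fe : edge G -> edge G') : Prop :=
  [/\ morphism fv fe, set_surj setT setT fv & set_surj setT setT fe].

Definition is_quotient (G G' : pgraph) : Prop :=
  exists fv fe, @surjective_morphism G G' fv fe.

Definition iso (G G' : pgraph) : Prop :=
  exists fv fe, [/\ @morphism G G' fv fe, bijective fv & bijective fe].

(* The equivalence relation identifying a with b and nothing else. *)
Definition glue (T : Type) (a b x y : T) : Prop :=
  [\/ x = y, x = a /\ y = b | x = b /\ y = a].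

(* G' is, up to isomorphism, the quotient of G by the equivalence relations RV
   on vertices and RE on edges. *)
Definition quotient_by (G : pgraph) (RV : vert G -> vert G -> Prop)
    (RE : edge G -> edge G -> Prop) (G' : pgraph) : Prop :=
  exists fv fe, [/\ @surjective_morphism G G' fv fe,
    forall x y, fv x = fv y <-> RV x y &
    forall e e', fe e = fe e' <-> RE e e'].

Definition merge_vertices (G : pgraph) (u v : vert G) (G' : pgraph) : Prop :=
  quotient_by (glue u v) eq G'.

Definition fold_step (G G' : pgraph) : Prop :=
  exists e1 e2 : edge G, [/\ e1 <> e2, lab e1 = lab e2 &
    (org e1 = org e2 /\ quotient_by (glue (ter e1) (ter e2)) (glue e1 e2) G') \/
    (ter e1 = ter e2 /\ quotient_by (glue (org e1) (org e2)) (glue e1 e2) G')].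

Definition folded (G : pgraph) : Prop :=
  forall e1 e2 : edge G, lab e1 = lab e2 ->
    org e1 = org e2 \/ ter e1 = ter e2 -> e1 = e2.

Definition immediate_quotient (G G' : pgraph) : Prop :=
  exists u v : vert G, u <> v /\ exists G0,
    [/\ merge_vertices u v G0, clos_refl_trans pgraph fold_step G0 G' &
        folded G'].

End Graphs.

Section CoreGraphs.
Variables (k : nat) (F : groupType) (X : 'I_k -> F).

Definition right_cosets (H : set F) : set (set F) :=
  [set C | exists w, C = [set h * w | h in H]].

Definition coset_shift (x : F) (C : set F) : set F := [set g * x | g in C].

Lemma right_cosets_shift (H : set F) (C : right_cosets H) (x : F) :
  coset_shift x (val C) \in right_cosets H.
Proof.
have [w ->] := set_valP C; apply/mem_set; exists (w * x).
rewrite /coset_shift image_comp; apply: eq_imagel => h _ /=.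
by rewrite mulgA.
Qed.

Lemma right_cosets_base (H : set F) : H \in right_cosets H.
Proof.
apply/mem_set; exists 1; rewrite -[LHS]image_id.
by apply: eq_imagel => h _; rewrite mulg1.
Qed.

(* The i-edge leaving the coset C is the pair (C, i). *)
Definition schreier (H : set F) : pgraph k :=
  @PGraph k (right_cosets H) (right_cosets H * 'I_k)%type
    fst (fun e => SigSub (right_cosets_shift e.1 (X e.2))) snd
    (SigSub (right_cosets_base H)).

Definition core_graph (H : set F) : pgraph k := core (schreier H).

Definition is_core_graph (G : pgraph k) : Prop :=
  exists L : set F, is_subgroup L /\ iso G (core_graph L).

(* Core graphs are considered up to isomorphism. *)
Definition quotient_chain (H J : set F) (m : nat) : Prop :=
  exists G : nat -> pgraph k,
    [/\ iso (G 0) (core_graph H), iso (G m) (core_graph J),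
        forall i, (i <= m)%N -> is_core_graph (G i) &
        forall i, (i < m)%N -> immediate_quotient (G i) (G i.+1)].

(* The value is 0 by convention when there is no chain from H to J. *)
Definition rho (H J : set F) : nat :=
  xget 0 [set m | quotient_chain H J m /\
    forall m', quotient_chain H J m' -> (m <= m')%N].

End CoreGraphs.

(* Main.v *)
Require Import Defs.
From mathcomp Require Import fingroup perm zify.
From Stdlib Require Import Relation_Operators.

(* Writing [pi G] for the subgroup of values of closed walks of [G] at its base
   vertex, an immediate quotient enlarges [pi] by one generator, so a chain of
   length m shows that J is generated by H and m elements.  Conversely, suppose
   that J is generated by H and s elements.  Attach s handles reading these
   elements to the core graph of H and fold.  A fold either removes an attached
   edge without touching the core graph, or it identifies two of its vertices,
   which amounts to an immediate quotient and uses up one handle.  When no fold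
   is left, the core graph maps injectively to that of J, hence isomorphically
   because the latter is a quotient of the former.  So rho(H, J) is the least
   number of elements which generate J together with H.

   If J = H * K, then K has rank rk J - rk H, and comparing ranks shows that no
   fewer elements suffice.  If rho(H, J) = rk J - rk H, then a basis of H and the
   elements given by a chain are rk J generators of J; since free groups of
   finite rank are Hopfian, they form a basis, and H is a free factor. *)

Set Implicit Arguments.
Unset Strict Implicit.
Unset Printing Implicit Defensive.

Local Open Scope classical_set_scope.
Local Open Scope group_scope.

Arguments reduced_word n w : simpl never.
Arguments base {k p}.

(** * Words and free bases *)

Section Words.
Variable n : nat.
Implicit Types (l : 'I_n * bool) (w : seq ('I_n * bool)).

(** What makes the handle argument count correctly is the difference between the numbers of attached
    edges and of attached vertices. A handle reading n > 0 letters brings n edges and n - 1 new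
    vertices, so it contributes 1. A fold that eliminates an attached vertex also eliminates an
    attached edge and keeps the difference; one that identifies two vertices of the core graph costs
    an edge only. At the end the difference is not negative, since the remaining edges still connect
    the attached vertices to the core graph.

    Freeness means uniqueness of reduced words, so a basis is recognized by refuting reduced
    relations. This is done in symmetric groups: a reduced word that is trivial under all maps of
    its letters to some ['S_N] is empty. Counting homomorphisms to these finite groups also gives
    the invariance of rank and the Hopf property, and evaluating walks in them gives the
    Nielsen-Schreier basis. *)

Definition inv_letter l := (l.1, ~~ l.2).
Definition inv_word w := rev (map inv_letter w).

Lemma inv_letterK l : inv_letter (inv_letter l) = l.
Proof. by case: l => i b; rewrite /inv_letter /= negbK. Qed.

Definition push_letter l w :=
  if w is l' :: w' then if l' == inv_letter l then w' else l :: w else [:: l].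
Definition reduce w := foldr push_letter [::] w.

Lemma reduced_cons l w :
  reduced_word (l :: w) =
  (if w is l' :: _ then l' != inv_letter l else true) && reduced_word w.
Proof. by case: w. Qed.

Lemma reduced_push l w : reduced_word w -> reduced_word (push_letter l w).
Proof.
case: w => [//|l' w] rw /=; case: eqP => [_|/eqP ne].
  by move: rw; rewrite reduced_cons => /andP[].
by rewrite reduced_cons ne.
Qed.

Lemma reduced_reduce w : reduced_word (reduce w).
Proof. by elim: w => //= l w IH; exact: reduced_push. Qed.

Lemma reduced_cat w1 w2 : reduced_word w1 -> reduced_word w2 ->
  (forall w1' l l' w2', w1 = rcons w1' l -> w2 = l' :: w2' ->
    l' != inv_letter l) ->
  reduced_word (w1 ++ w2).
Proof.
elim: w1 => //= l w1 IH; rewrite reduced_cons => /andP[h r1] r2 H.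
rewrite [(_ :: _)]/= reduced_cons; apply/andP; split; last first.
  by apply: IH => // w1' l1 l2 w2' e1 e2; apply: (H (l :: w1') l1 l2 w2');
    rewrite // e1.
case: w1 h r1 H {IH} => [|l1 w1] //= _ _ H.
by case: w2 r2 H => //= l2 w2 _ H; apply: (H [::] l l2 w2).
Qed.

Lemma inv_word_cons l w : inv_word (l :: w) = rcons (inv_word w) (inv_letter l).
Proof. by rewrite /inv_word /= rev_cons. Qed.

Lemma reduced_inv w : reduced_word w -> reduced_word (inv_word w).
Proof.
elim: w => //= l w IH; rewrite reduced_cons inv_word_cons -cats1 => /andP[h r].
apply: reduced_cat => //; first exact: IH.
move=> w1 l1 l2 w2 e [<- _].
case: w h r e {IH} => [|l3 w] h r; first by case: w1.
rewrite inv_word_cons => /rcons_inj[_ <-].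
by rewrite inv_letterK eq_sym.
Qed.

End Words.

Section Evaluation.
Variable F : groupType.

Section Family.
Variables (n : nat) (g : 'I_n -> F).
Implicit Types (l : 'I_n * bool) (w : seq ('I_n * bool)).

Lemma word_val0 : word_val g [::] = 1.
Proof. by rewrite /word_val big_nil. Qed.

Lemma word_val_cons l w : word_val g (l :: w) = letter_val g l * word_val g w.
Proof. by rewrite /word_val big_cons. Qed.

Lemma word_val1 l : word_val g [:: l] = letter_val g l.
Proof. by rewrite word_val_cons word_val0 mulg1. Qed.

Lemma word_val_cat w1 w2 :
  word_val g (w1 ++ w2) = word_val g w1 * word_val g w2.
Proof. by rewrite /word_val big_cat. Qed.

Lemma word_val_rcons w l : word_val g (rcons w l) = word_val g w * letter_val g l.
Proof. by rewrite -cats1 word_val_cat word_val1. Qed.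

Lemma letter_val_inv l : letter_val g (inv_letter l) = (letter_val g l)^-1.
Proof. by case: l => i [] /=; rewrite /letter_val /= ?invgK. Qed.

Lemma word_val_inv w : word_val g (inv_word w) = (word_val g w)^-1.
Proof.
elim: w => [|l w IH]; first by rewrite /inv_word /= word_val0 invg1.
by rewrite inv_word_cons word_val_rcons word_val_cons IH letter_val_inv invgM.
Qed.

Lemma word_val_push l w :
  word_val g (push_letter l w) = letter_val g l * word_val g w.
Proof.
case: w => [|l' w]; first by rewrite word_val1 word_val0 mulg1.
rewrite /push_letter; case: eqP => [->|_]; last exact: word_val_cons.
by rewrite word_val_cons letter_val_inv mulVKg.
Qed.

Lemma word_val_reduce w : word_val g (reduce w) = word_val g w.
Proof. by elim: w => //= l w IH; rewrite word_val_push IH word_val_cons. Qed.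

Lemma is_subgroup_range : is_subgroup (range (word_val g)).
Proof.
split=> [|_ _ [w1 _ <-] [w2 _ <-]|_ [w _ <-]].
- by exists [::]; rewrite ?word_val0.
- by exists (w1 ++ w2); rewrite ?word_val_cat.
- by exists (inv_word w); rewrite ?word_val_inv.
Qed.

Lemma range_gen i : range (word_val g) (g i).
Proof. by exists [:: (i, true)]; rewrite ?word_val1. Qed.

Lemma subgroup_letter (J : set F) l :
  is_subgroup J -> (forall i, J (g i)) -> J (letter_val g l).
Proof.
by case=> _ _ JV Jg; rewrite /letter_val; case: ifP => _; [|apply: JV].
Qed.

Lemma range_sub (J : set F) :
  is_subgroup J -> (forall i, J (g i)) -> range (word_val g) `<=` J.
Proof.
move=> HJ Jg _ [w _ <-]; have [J1 JM JV] := HJ.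
elim: w => [|l w IH]; first by rewrite word_val0.
by rewrite word_val_cons; apply: JM IH; exact: subgroup_letter.
Qed.

(** Two nonempty reduced words of equal value either share their first letter, which cancels, or
    make [inv_word w1 ++ w2] a nonempty reduced relation. *)
Lemma free_basisP (J : set F) :
  free_basis g J <->
  J = range (word_val g) /\
  forall w, reduced_word w -> word_val g w = 1 -> w = [::].
Proof.
split=> [[im inj sur]|[-> triv]].
  split=> [|w rw w1].
    apply/seteqP; split=> [x /sur[w _ <-]|x [w _ <-]]; first by exists w.
    by rewrite -word_val_reduce; apply: im; exact: reduced_reduce.
  apply: inj; rewrite ?inE //=; first exact: mem_set.
    exact: mem_set.
  by rewrite w1 word_val0.
split=> [w _|w1 w2 /set_mem r1 /set_mem r2 /=|x [w _ <-]]; first by exists w.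
- elim: w1 w2 r1 r2 => [|l1 w1 IH] [|l2 w2] //= r1 r2.
  + by rewrite word_val0 => /esym/(triv _ r2).
  + by rewrite word_val0 => /(triv _ r1).
  have [<-|/eqP ne] := l1 =P l2.
    rewrite !word_val_cons => /mulgI e; congr (_ :: _); apply: IH e.
      by move: r1; rewrite reduced_cons => /andP[].
    by move: r2; rewrite reduced_cons => /andP[].
  move=> e; have /triv : reduced_word (inv_word (l1 :: w1) ++ l2 :: w2).
    apply: reduced_cat => //; first exact: reduced_inv.
    move=> w l l' w' + [<- _]; rewrite inv_word_cons => /rcons_inj[_ <-].
    by rewrite inv_letterK eq_sym.
  rewrite word_val_cat word_val_inv e mulVg => /(_ erefl).
  by rewrite inv_word_cons; case: (inv_word w1).
- by exists (reduce w); [exact: reduced_reduce|exact: word_val_reduce].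
Qed.

End Family.

End Evaluation.

(** Well-definedness of the homomorphism from [J] to [K] sending [g i] to [s i]: words of equal
    value in [J] have the same reduced form, and reduction preserves values in every group. *)
Lemma free_basis_eval (F K : groupType) n (g : 'I_n -> F) (s : 'I_n -> K)
    (J : set F) w w' :
  free_basis g J -> word_val g w = word_val g w' ->
  word_val s w = word_val s w'.
Proof.
move=> [_ inj _]; rewrite -[word_val g w]word_val_reduce.
rewrite -[word_val g w']word_val_reduce => e.
rewrite -[LHS]word_val_reduce -[RHS]word_val_reduce; congr word_val.
by apply: inj e; apply/mem_set; exact: reduced_reduce.
Qed.

(** * Rank and the Hopf property *)

(** A new point [x] is handled by composing with the transposition of [p x] and [f x]; both points
    lie outside the image of [s], by injectivity of [p] and of [f]. *)
Lemma perm_extend (T : finType) (f : T -> T) (s : seq T) :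
  {in s &, injective f} -> exists p : {perm T}, {in s, p =1 f}.
Proof.
elim: s => [|x s IH] inj; first by exists 1.
have [|p pf] := IH.
  by move=> y z ys zs; apply: inj; rewrite inE ?ys ?zs orbT.
have [xs|xs] := boolP (x \in s).
  by exists p => y; rewrite inE => /orP[/eqP ->|]; apply: pf.
exists (p * tperm (p x) (f x)) => y; rewrite inE permM => /predU1P[->|ys].
  by rewrite tpermL.
rewrite tpermD ?(pf _ ys) //.
  by rewrite -(pf _ ys); apply: contraNneq xs => /perm_inj ->.
apply: contraNneq xs => e; suff -> : x = y by [].
by apply: inj e; rewrite inE ?eqxx ?ys ?orbT.
Qed.

(* Free groups are residually finite: the letters of [w] prescribe a partial
   permutation of the prefixes of [w], extended to a permutation in which [w]
   moves the empty prefix to the full one. *)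
Lemma reduced_perm_trivial n (w : seq ('I_n * bool)) : reduced_word w ->
  (forall N (s : 'I_n -> 'S_N), word_val s w = 1) -> w = [::].
Proof.
move=> rw triv; apply/eqP; apply: contraT => w0.
have [l0 _] : exists l0 : 'I_n * bool, True by case: w w0 {rw triv} => // l; exists l.
have sw : (0 < size w)%N by rewrite lt0n size_eq0.
pose N := size w.
pose L x := nth l0 w x.
have red x : (x.+1 < N)%N -> L x.+1 != inv_letter (L x).
  rewrite /L /N; elim: (w) rw x => //= l [|l' w'] IH // r [|x] /= h.
    by move: r; rewrite reduced_cons => /andP[].
  by apply: IH => //; move: r; rewrite reduced_cons => /andP[].
(* Permutations multiply from left to right, so reading the letter at position [x] must move [x] to
   [x.+1]. Thus the generator [i] moves [x] forward if that letter is [i], and backward if the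
   letter just before [x] is the inverse of [i]. *)
pose out i (x : 'I_N.+1) := (x < N)%N && (L x == (i, true)).
pose inn i (x : 'I_N.+1) := (0 < x)%N && (L x.-1 == (i, false)).
pose f i (x : 'I_N.+1) : 'I_N.+1 := if out i x then inord x.+1 else inord x.-1.
have excl i x : out i x -> inn i x -> False.
  case/andP=> xN /eqP e /andP[x0 /eqP e']; have := red x.-1.
  by rewrite prednK // e e' eqxx => /(_ xN).
(* A forward and a backward move with the same target would make two consecutive letters cancel. *)
have step i (x y : 'I_N.+1) :
    out i x || inn i x -> out i y || inn i y -> out i x -> ~~ out i y ->
    f i x <> f i y.
  rewrite /f => _ /orP[->|iy] // ox oy; rewrite ox (negPf oy).
  have [/andP[xN /eqP ex] /andP[y0 /eqP ey]] := (ox, iy).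
  have yN := ltn_ord y; have xN' := ltn_ord x.
  move=> /(congr1 val); rewrite /= !inordK; [|lia|lia] => e.
  by have := red x; rewrite e ey ex eqxx => /(_ _)/negP[] //; lia.
have [s sE] : exists s : 'I_n -> 'S_N.+1,
    forall i x, out i x || inn i x -> s i x = f i x.
  have ex i : exists p : 'S_N.+1, {in enum [pred x | out i x || inn i x], p =1 f i}.
    apply: perm_extend => x y; rewrite !mem_enum !inE => hx hy e.
    have [ox|ox] := boolP (out i x); have [oy|oy] := boolP (out i y).
    - move: e; rewrite /f ox oy => /(congr1 val).
      case/andP: ox => ox _; case/andP: oy => oy _.
      by rewrite /= !inordK // => -[] /val_inj.
    - by case: (step i x y).
    - by case: (step i y x).
    - move: hx hy e; rewrite /f (negPf ox) (negPf oy) /= => /andP[x0 _] /andP[y0 _].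
      have yN := ltn_ord y; have xN' := ltn_ord x.
      move=> /(congr1 val); rewrite /= !inordK; [|lia|lia] => e; apply: val_inj => /=.
      lia.
  exists (fun i => projT1 (cid (ex i))) => i x h.
  by case: cid => p /= ->//; rewrite mem_enum inE.
have pre x : (x <= N)%N -> word_val s (take x w) (inord 0 : 'I_N.+1) = inord x.
  elim: x => [|x IH] xN; first by rewrite take0 word_val0 perm1.
  rewrite (take_nth l0) // word_val_rcons permM IH; last lia.
  rewrite -/(L x); have := erefl (L x).
  case: {2 3}(L x) => i [] e; rewrite /letter_val /=.
    have o : out i (inord x) by rewrite /out inordK ?e ?eqxx ?andbT //; lia.
    by rewrite sE ?o // /f o inordK //; lia.
  have o : inn i (inord x.+1) by rewrite /inn inordK //= ?e ?eqxx //; lia.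
  have no : ~~ out i (inord x.+1) by apply/negP => /excl/(_ o).
  have := sE i (inord x.+1); rewrite o orbT => /(_ isT).
  rewrite /f (negPf no) inordK //= => <-.
  by rewrite permK.
have := pre N (leqnn _); rewrite take_size triv perm1 => /(congr1 val) /=.
by rewrite !inordK //; rewrite /N; lia.
Qed.

Section Rank.
Variable F : groupType.
Implicit Type J : set F.

Definition subst_word n m (u : 'I_m -> seq ('I_n * bool)) (w : seq ('I_m * bool)) :=
  flatten [seq if l.2 then u l.1 else inv_word (u l.1) | l <- w].

Lemma word_val_subst (K : groupType) n m (s : 'I_n -> K)
    (u : 'I_m -> seq ('I_n * bool)) w :
  word_val s (subst_word u w) = word_val (fun i => word_val s (u i)) w.
Proof.
elim: w => [|l w IH]; first by rewrite !word_val0.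
rewrite /subst_word /= word_val_cat word_val_cons -IH; congr (_ * _).
by rewrite /letter_val; case: ifP => // _; rewrite word_val_inv.
Qed.

(* A map [s : 'I_n -> K] stands for the homomorphism from the free group [J] to
   [K] sending [b i] to [s i]; its value at [g i] is [word_val s (u i)]. *)
Lemma basis_restrict n m (b : 'I_n -> F) (g : 'I_m -> F) J :
  free_basis b J -> J = range (word_val g) ->
  exists u : 'I_m -> seq ('I_n * bool),
    (forall i, word_val b (u i) = g i) /\
    forall (K : groupType) (s s' : 'I_n -> K),
      (forall i, word_val s (u i) = word_val s' (u i)) -> s =1 s'.
Proof.
move=> bJ Jg; have [Jb _] := (free_basisP _ _).1 bJ.
have /choice[u uE] : forall i, exists v, word_val b v = g i.
  by move=> i; have := range_gen g i; rewrite -Jg Jb => -[v _ <-]; exists v.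
have /choice[v vE] : forall j, exists v, word_val g v = b j.
  by move=> j; have := range_gen b j; rewrite -Jb Jg => -[v _ <-]; exists v.
exists u; split=> // K s s' e j.
have gE : (fun i => word_val b (u i)) = g by apply/funext.
have key (r : 'I_n -> K) : r j = word_val (fun i => word_val r (u i)) (v j).
  rewrite -word_val_subst -[LHS](word_val1 r (j, true)).
  by apply: (free_basis_eval _ bJ); rewrite word_val_subst gE vE word_val1.
by rewrite key (key s'); congr word_val; apply/funext.
Qed.

(** There are [2 ^ n] homomorphisms from [J] to the two-element group ['S_2], and each is determined
    by its values on the [m] generators. *)
Lemma basis_leq n m (b : 'I_n -> F) (g : 'I_m -> F) J :
  free_basis b J -> J = range (word_val g) -> (n <= m)%N.
Proof.
move=> bJ /(basis_restrict bJ)[u [_ inj]].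
have : injective (fun s : {ffun 'I_n -> 'S_2} => [ffun i => word_val s (u i)]).
  move=> s s' e; apply/ffunP; apply: inj => i.
  by move/ffunP/(_ i): e; rewrite !ffunE.
move/leq_card; rewrite !card_ffun !card_ord card_Sn.
by rewrite leq_exp2l.
Qed.

Lemma basis_size n m (b : 'I_n -> F) (c : 'I_m -> F) J :
  free_basis b J -> free_basis c J -> n = m.
Proof.
move=> bJ cJ; have [Jb _] := (free_basisP _ _).1 bJ.
have [Jc _] := (free_basisP _ _).1 cJ.
by apply/eqP; rewrite eqn_leq (basis_leq bJ Jc) (basis_leq cJ Jb).
Qed.

Lemma rk_basis n (b : 'I_n -> F) J : free_basis b J -> rk J = n.
Proof.
move=> bJ; rewrite /rk; case: xgetP => [_ -> [c cJ]|/(_ n)[]].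
  exact: basis_size cJ bJ.
by exists b.
Qed.

(* Free groups of finite rank are Hopfian: precomposition with a surjective
   endomorphism permutes the finite set of homomorphisms to a finite group. *)
Lemma generating_basis n (b g : 'I_n -> F) J :
  free_basis b J -> J = range (word_val g) -> free_basis g J.
Proof.
move=> bJ Jg; apply/free_basisP; split=> // w rw w1.
have [u [uE inj]] := basis_restrict bJ Jg.
apply: reduced_perm_trivial => // N s.
pose Phi (t : {ffun 'I_n -> 'S_N}) := [ffun i => word_val t (u i)].
have Phi_inj : injective Phi.
  move=> t t' e; apply/ffunP; apply: inj => i.
  by move/ffunP/(_ i): e; rewrite !ffunE.
(* So the assignment [s] to the letters of [w] is induced by a homomorphism on [J], and [w]
   evaluates to the image of 1. *)
have /codomP[t tE] : [ffun i => s i] \in codom Phi.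
  by apply: inj_card_onto => //.
have -> : s = fun i => word_val t (u i).
  by apply/funext => i; move/ffunP/(_ i): tE; rewrite !ffunE.
rewrite -word_val_subst -[RHS](word_val0 t); apply: (free_basis_eval _ bJ).
rewrite word_val_subst word_val0 -w1; congr word_val; exact/funext.
Qed.

End Rank.

(** * Walks in labelled graphs *)

Section Walks.
Variable k : nat.
Implicit Types G : pgraph k.

Definition wlab G (p : seq (edge G * bool)) : seq ('I_k * bool) :=
  [seq (lab d.1, d.2) | d <- p].

Definition inv_step G (d : edge G * bool) := (d.1, ~~ d.2).
Definition rev_walk G (p : seq (edge G * bool)) := rev (map (@inv_step G) p).

(** The values sit on edges rather than labels, so that edges with the same label can be told apart
    in the Nielsen-Schreier theorem. *)
Definition walk_val G (K : groupType) (t : edge G -> K) (p : seq (edge G * bool)) : K :=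
  \prod_(d <- p) (if d.2 then t d.1 else (t d.1)^-1).

Section OneGraph.
Variable G : pgraph k.
Implicit Types (x y z : vert G) (p q : seq (edge G * bool)) (d : edge G * bool).

Lemma src_inv d : src (inv_step d) = tgt d.
Proof. by case: d => e []. Qed.

Lemma tgt_inv d : tgt (inv_step d) = src d.
Proof. by case: d => e []. Qed.

Lemma walk_cat x p q z :
  walk x (p ++ q) z <-> exists y, walk x p y /\ walk y q z.
Proof.
elim: p x => [|d p IH] x /=; first by split=> [h|[y [<- //]]]; exists x.
split=> [[e /IH[y [h1 h2]]]|[y [[e h1] h2]]]; first by exists y.
by split=> //; apply/IH; exists y.
Qed.

Lemma walk_rcons x p d z : walk x (rcons p d) z <-> walk x p (src d) /\ tgt d = z.
Proof.
rewrite -cats1 walk_cat; split=> [[y [h [e h']]]|[h <-]]; first by rewrite e.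
by exists (src d).
Qed.

Lemma rev_walk_cons d p : rev_walk (d :: p) = rcons (rev_walk p) (inv_step d).
Proof. by rewrite /rev_walk /= rev_cons. Qed.

Lemma walk_rev x p y : walk x p y -> walk y (rev_walk p) x.
Proof.
elim: p x => [|d p IH] x /=; first by move->.
by case=> <- /IH h; rewrite rev_walk_cons walk_rcons src_inv tgt_inv.
Qed.

Section Value.
Variables (K : groupType) (t : edge G -> K).

Lemma walk_val_nil : walk_val t [::] = 1.
Proof. by rewrite /walk_val big_nil. Qed.

Lemma walk_val_cons d p :
  walk_val t (d :: p) = (if d.2 then t d.1 else (t d.1)^-1) * walk_val t p.
Proof. by rewrite /walk_val big_cons. Qed.

Lemma walk_val_cat p q : walk_val t (p ++ q) = walk_val t p * walk_val t q.
Proof. by rewrite /walk_val big_cat. Qed.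

Lemma walk_val_rev p : walk_val t (rev_walk p) = (walk_val t p)^-1.
Proof.
elim: p => [|d p IH]; first by rewrite /rev_walk /= walk_val_nil invg1.
rewrite rev_walk_cons -cats1 walk_val_cat walk_val_cons IH walk_val_cons.
by rewrite walk_val_nil mulg1 invgM; case: d => e [] /=; rewrite ?invgK.
Qed.

End Value.

Lemma wlab_cat p q : wlab (p ++ q) = wlab p ++ wlab q.
Proof. exact: map_cat. Qed.

Lemma word_val_wlab (K : groupType) (X : 'I_k -> K) p :
  word_val X (wlab p) = walk_val (fun e => X (lab e)) p.
Proof.
elim: p => [|d p IH]; first by rewrite word_val0 walk_val_nil.
by rewrite /= word_val_cons walk_val_cons IH.
Qed.

Lemma word_val_rev (K : groupType) (X : 'I_k -> K) p :
  word_val X (wlab (rev_walk p)) = (word_val X (wlab p))^-1.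
Proof. by rewrite !word_val_wlab walk_val_rev. Qed.

Lemma reduced_wlab p : reduced_word (wlab p) -> reduced_walk p.
Proof.
move=> + p1 e b p2 pE; rewrite {}pE wlab_cat /=.
elim: p1 => [|d p1 IH] /=; first by rewrite reduced_cons /inv_letter /= eqxx.
by rewrite reduced_cons => /andP[_].
Qed.

Hypothesis fG : folded G.

Lemma step_det d d' : src d = src d' -> (lab d.1, d.2) = (lab d'.1, d'.2) -> d = d'.
Proof.
case: d d' => [e b] [e' b']; rewrite /src /= => h [l bE].
rewrite -bE in h *; suff -> : e = e' by [].
by apply: fG => //; case: b h {bE} => h; [left|right].
Qed.

Lemma walk_det x p p' y y' :
  walk x p y -> walk x p' y' -> wlab p = wlab p' -> p = p' /\ y = y'.
Proof.
elim: p p' x => [|d p IH] [|d' p'] x //=; first by move=> <- <-.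
move=> [sd h] [sd' h'] [l1 l2 l3].
have e : d = d'.
  by apply: step_det; [rewrite sd sd'|rewrite l1 l2].
by rewrite -e in h' *; have [-> ->] := IH _ _ h h' l3.
Qed.

Lemma wlab_reduced x p y : walk x p y -> reduced_walk p -> reduced_word (wlab p).
Proof.
elim: p x => [|d p IH] x //= [sd h] rp; rewrite reduced_cons.
rewrite (IH _ h); last by move=> p1 e b p2 pE; apply: (rp (d :: p1) e b p2); rewrite pE.
rewrite andbT; case: p h rp {IH} => [|d' p] //= [sd' h] rp.
apply/eqP => e; have dE : d' = inv_step d.
  by apply: step_det; rewrite ?sd' ?src_inv.
by apply: (rp [::] d.1 d.2 p); rewrite dE; case: (d).
Qed.

(** In a folded graph two consecutive steps with cancelling labels run back and forth along one
    edge. Removing them therefore preserves values taken on edges, not only on labels, and uses no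
    new edge. *)
Lemma reduce_walk x p y : walk x p y -> exists q,
  [/\ walk x q y, reduced_word (wlab q),
      forall (K : groupType) (t : edge G -> K), walk_val t q = walk_val t p &
      forall P : edge G -> Prop, List.Forall (fun d => P d.1) p ->
        List.Forall (fun d => P d.1) q].
Proof.
elim: p x => [|d p IH] x /=; first by move->; exists [::].
move=> [sd /IH[q [wq rq vq Pq]]].
case: q wq rq vq Pq => [|d' q] wq rq vq Pq.
  exists [:: d]; split=> // [K t|P /List.Forall_cons_iff[Pd _]].
    by rewrite !walk_val_cons -vq.
  by constructor.
have [e|/eqP ne] := (lab d'.1, d'.2) =P inv_letter (lab d.1, d.2).
  case: wq => sd' wq; have dE : d' = inv_step d.
    by apply: step_det; rewrite ?sd' ?src_inv.
  exists q; split=> [||K t|P /List.Forall_cons_iff[_ /Pq]].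
  - by rewrite -sd -(tgt_inv d) -dE.
  - by move: rq; rewrite /= reduced_cons => /andP[].
  - rewrite walk_val_cons -vq walk_val_cons dE /=.
    by case: (d.2) => /=; rewrite ?mulKg ?mulVKg.
  - by move/List.Forall_cons_iff => [].
exists [:: d, d' & q]; split=> // [|K t|P /List.Forall_cons_iff[Pd /Pq Pq']].
- by rewrite [wlab _]/= reduced_cons ne.
- by rewrite walk_val_cons vq walk_val_cons.
- by constructor.
Qed.

End OneGraph.

Section Morphisms.
Variables (G G' : pgraph k) (fv : vert G -> vert G') (fe : edge G -> edge G').
Hypothesis f : morphism fv fe.

Definition map_walk (p : seq (edge G * bool)) := [seq (fe d.1, d.2) | d <- p].

Lemma src_map d : src (fe d.1, d.2) = fv (src d).
Proof. by case: f => _ fo ft _; case: d => e [] /=; rewrite /src /= ?fo ?ft. Qed.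

Lemma tgt_map d : tgt (fe d.1, d.2) = fv (tgt d).
Proof. by case: f => _ fo ft _; case: d => e [] /=; rewrite /tgt /= ?fo ?ft. Qed.

Lemma walk_map x p y : walk x p y -> walk (fv x) (map_walk p) (fv y).
Proof.
elim: p x => [|d p IH] x /=; first by move->.
by move=> [<- /IH h]; rewrite src_map tgt_map.
Qed.

Lemma wlab_map p : wlab (map_walk p) = wlab p.
Proof.
case: f => _ _ _ fl; rewrite /wlab -map_comp; apply: eq_map => d /=.
by rewrite fl.
Qed.

End Morphisms.

End Walks.

(** * Subgroups of values of closed walks *)

Section Values.
Variables (k : nat) (F : groupType) (X : 'I_k -> F).
Implicit Types G : pgraph k.

Definition reach G (x : vert G) (g : F) (y : vert G) :=
  exists p, walk x p y /\ word_val X (wlab p) = g.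

Definition pi G : set F := [set g | @reach G base g base].

Definition connected G := forall v : vert G, exists g, reach base g v.

Lemma reach_refl G (x : vert G) : reach x 1 x.
Proof. by exists [::]; rewrite word_val0. Qed.

Lemma reach_trans G (x y z : vert G) g h :
  reach x g y -> reach y h z -> reach x (g * h) z.
Proof.
move=> [p [wp <-]] [q [wq <-]]; exists (p ++ q).
by rewrite wlab_cat word_val_cat; split=> //; apply/walk_cat; exists y.
Qed.

Lemma reach_sym G (x y : vert G) g : reach x g y -> reach y g^-1 x.
Proof.
move=> [p [wp <-]]; exists (rev_walk p); split; first exact: walk_rev.
by rewrite word_val_rev.
Qed.

Lemma reach_edge G (e : edge G) : reach (org e) (X (lab e)) (ter e).
Proof. by exists [:: (e, true)]; rewrite /= word_val1. Qed.

Lemma is_subgroup_pi G : is_subgroup (pi G).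
Proof.
split; first exact: reach_refl.
- by move=> g h; exact: reach_trans.
- by move=> g; exact: reach_sym.
Qed.

Lemma reach_map G G' (fv : vert G -> vert G') fe x g y :
  morphism fv fe -> reach x g y -> reach (fv x) g (fv y).
Proof.
move=> f [p [wp <-]]; exists (map_walk fe p); split.
  exact: walk_map f _ _ _ wp.
by rewrite (wlab_map f).
Qed.

Lemma pi_map G G' (fv : vert G -> vert G') fe :
  morphism fv fe -> pi G `<=` pi G'.
Proof. by move=> f g /(reach_map f); case: f => fb _ _ _; rewrite fb. Qed.

Lemma connected_map G G' (fv : vert G -> vert G') fe :
  surjective_morphism fv fe -> connected G -> connected G'.
Proof.
move=> [f sv _] cG v; have [v0 _ <-] := sv v I; have [g h] := cG v0.
by exists g; move/(reach_map f): h; case: f => ->.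
Qed.

Hypothesis hX : free_basis X [set: F].

Lemma reduced_eq w w' : reduced_word w -> reduced_word w' ->
  word_val X w = word_val X w' -> w = w'.
Proof. by case: hX => _ inj _ r r'; apply: inj; apply/mem_set. Qed.

(** Freeness of [X] enters here: the reduced form of any walk with this value must be labelled by
    [w] itself. *)
Lemma reach_reduced G (x y : vert G) w : folded G -> reduced_word w ->
  reach x (word_val X w) y -> exists2 p, walk x p y & wlab p = w.
Proof.
move=> fG rw [p [/(reduce_walk fG)[q [wq rq vq _]] e]]; exists q => //.
by apply: reduced_eq => //; rewrite word_val_wlab vq -word_val_wlab.
Qed.

Lemma reach_word G (x y : vert G) g : folded G -> reach x g y ->
  exists p, [/\ walk x p y, reduced_word (wlab p) & word_val X (wlab p) = g].
Proof.
move=> fG [p [/(reduce_walk fG)[q [wq rq vq _]] <-]]; exists q; split=> //.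
by rewrite !word_val_wlab.
Qed.

Lemma reach_det G (x y y' : vert G) g : folded G ->
  reach x g y -> reach x g y' -> y = y'.
Proof.
move=> fG /(reach_word fG)[p [wp rp <-]] /(reach_reduced fG rp)[q wq e].
by have [_] := walk_det fG wq wp e.
Qed.

(** An intrinsic form of [is_core_graph] that can be checked directly on a graph obtained by
    folding; see [core_like_is_core_graph]. *)
Definition core_like G := [/\ folded G, connected G & forall e, core_edges (G := G) e].

Lemma inj_surj_bijective (A B : Type) (f : A -> B) :
  injective f -> (forall y, exists x, f x = y) -> bijective f.
Proof.
move=> inj /choice[g gK]; exists g => x; last exact: gK.
by apply: inj; rewrite gK.
Qed.

(** Walks to two vertices with the same image differ by an element of [pi X G'], hence of [pi X G],
    so the vertices agree by determinism. An edge of [G'] lies on a reduced closed walk, whose label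
    is also read by a closed walk of [G]. *)
Lemma iso_of_morphism G G' (fv : vert G -> vert G') fe :
  folded G -> connected G -> core_like G' -> morphism fv fe ->
  pi G' `<=` pi G -> iso G G'.
Proof.
move=> fG cG [fG' cG' coreG'] f sub; have [fb fo ft fl] := f.
have ivs : injective fv.
  move=> x y e; have [g gx] := cG x; have [h hy] := cG y.
  have gh : pi G (g * h^-1).
    apply/sub/(@reach_trans _ _ (fv x)); first by rewrite -fb; apply: reach_map gx.
    by rewrite e -fb; apply: reach_sym; apply: reach_map hy.
  apply: (reach_det fG gx); rewrite -[g](mulgVK h).
  exact: reach_trans gh hy.
have sfe e' : exists e, fe e = e'.
  have [p1 [b [p2 [wp rp]]]] := coreG' e'.
  have [q wq qE] : exists2 q, walk (base : vert G) q base &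
      wlab q = wlab (p1 ++ (e', b) :: p2).
    apply: (reach_reduced fG); first exact: wlab_reduced wp rp.
    by apply: sub; exists (p1 ++ (e', b) :: p2).
  have [mq _] : map_walk fe q = p1 ++ (e', b) :: p2 /\ base = base :> vert G'.
    have := walk_map f wq; rewrite fb => wq'.
    by apply: walk_det wq' wp _; rewrite ?(wlab_map f).
  have : List.In (e', b) (map_walk fe q).
    by rewrite mq; apply: List.in_elt.
  by move=> /List.in_map_iff[d [[<- _] _]]; exists d.1.
have sfv y : exists x, fv x = y.
  have [g [p [wp _]]] := cG' y.
  case/lastP: p wp => [<-|p d]; first by exists base.
  rewrite walk_rcons => -[_ <-]; have [e eE] := sfe d.1.
  by exists (tgt (e, d.2)); rewrite -(tgt_map f) /= eE -surjective_pairing.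
exists fv, fe; split=> //; apply: inj_surj_bijective => // e1 e2 e12.
apply: fG; first by rewrite -!fl e12.
by left; apply: ivs; rewrite -!fo e12.
Qed.

End Values.

(** * Core graphs *)

Lemma In_mem (T : eqType) (x : T) s : List.In x s <-> x \in s.
Proof.
elim: s => //= y s IH; rewrite inE; split=> [[->|/IH ->]|].
- by rewrite eqxx.
- by rewrite orbT.
- by case/predU1P=> [->|/IH]; [left|right].
Qed.

(** A covering list rather than a [finType], because the edges of a graph form an arbitrary type. *)
Definition finite_edges k (G : pgraph k) :=
  exists s : seq (edge G), forall e, List.In e s.

Lemma In_split (T : Type) (x : T) s : List.In x s -> exists s1 s2, s = s1 ++ x :: s2.
Proof. exact: List.in_split. Qed.

Lemma In_cat (T : Type) (x : T) s1 s2 :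
  List.In x (s1 ++ s2) <-> List.In x s1 \/ List.In x s2.
Proof. exact: List.in_app_iff. Qed.

Lemma Forall_cat (T : Type) (P : T -> Prop) s1 s2 :
  List.Forall P (s1 ++ s2) <-> List.Forall P s1 /\ List.Forall P s2.
Proof. exact: List.Forall_app. Qed.

Lemma In_flatten_map (I : eqType) (T : Type) (f : I -> seq T) s i x :
  i \in s -> List.In x (f i) -> List.In x (flatten (map f s)).
Proof.
elim: s => //= j s IH; rewrite inE => /predU1P[->|/IH h] xi.
  by apply/In_cat; left.
by apply/In_cat; right; apply: h.
Qed.

Lemma Forall_rev_walk k (G : pgraph k) (P : edge G -> Prop) (p : seq (edge G * bool)) :
  List.Forall (fun d => P d.1) p -> List.Forall (fun d => P d.1) (rev_walk p).
Proof.
elim: p => //= d p IH /List.Forall_cons_iff[Pd /IH Pp].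
by rewrite rev_walk_cons -cats1; apply/Forall_cat; split=> //; constructor.
Qed.

Section Core.
Variable k : nat.
Implicit Types G : pgraph k.

Lemma core_val_morphism G : morphism (G := core G) (G' := G) val val.
Proof. by []. Qed.

Lemma walk_core_edges G (p : seq (edge G * bool)) :
  walk base p base -> reduced_walk p -> List.Forall (fun d => core_edges d.1) p.
Proof.
move=> wp rp; apply/List.Forall_forall; move=> [e b] ep.
have [p1 [p2 pE]] := In_split ep.
by exists p1, b, p2; rewrite /= -pE.
Qed.

Lemma walk_core G (x : vert (core G)) p y : walk (val x) p y ->
  List.Forall (fun d => core_edges d.1) p ->
  exists q (z : vert (core G)),
    [/\ walk x q z, val z = y & map_walk (G := core G) (G' := G) val q = p].
Proof.
elim: p x => [|[e b] p IH] x /=; first by move=> <- _; exists [::], x.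
move=> [sd wp] /List.Forall_cons_iff[/= /mem_set ce cp].
pose d : edge (core G) * bool := (SigSub ce, b).
have [|q [z [wq <- qp]]] := IH (tgt d) _ cp.
  by rewrite -(tgt_map (core_val_morphism G)).
exists (d :: q), z; split=> //; last by rewrite /= qp.
split=> //; apply: val_inj.
exact: etrans (esym (src_map (core_val_morphism G) d)) sd.
Qed.

(** A core vertex other than the base lies on a reduced closed walk, all of whose edges are core
    edges; its initial segment stays in the core. *)
Lemma connected_core G (x : vert (core G)) :
  exists p, walk base p x.
Proof.
have main y : core_verts (G := G) y ->
    exists p, walk base p y /\ List.Forall (fun d => core_edges d.1) p.
  case=> [->|[e [[p1 [b [p2 [wp rp]]]] ey]]]; first by exists [::].
  have := walk_core_edges wp rp.
  move/Forall_cat => [c1 /List.Forall_cons_iff[/= ce c2]].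
  have [z [w1 /= [sz w2]]] := (walk_cat _ _ _ _).1 wp.
  have [yE|yE] : y = src (e, b) \/ y = tgt (e, b).
    by case: ey => <-; case: (b); [left|right|right|left].
    by exists p1; rewrite yE sz.
  exists (rcons p1 (e, b)); rewrite walk_rcons sz yE; split=> //.
  by rewrite -cats1; apply/Forall_cat; split=> //; constructor.
have [p [wp cp]] := main _ (set_mem (valP x)).
have [q [z [wq zx _]]] := walk_core (x := base) wp cp.
by exists q; rewrite -(val_inj zx).
Qed.

Lemma core_core_edges G (e : edge (core G)) : core_edges e.
Proof.
have [p1 [b [p2 [wp rp]]]] := set_mem (valP e).
have [q [z [wq zb qp]]] := walk_core (x := base) wp (walk_core_edges wp rp).
have zE : z = base by apply: val_inj.
rewrite zE in wq; pose mw := map_walk (G := core G) (G' := G) val.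
have : List.In (val e, b) (mw q) by rewrite /mw qp; apply: List.in_elt.
move=> /List.in_map_iff[d [[dE1 dE2] dq]].
have [q1 [q2 qE]] := In_split dq.
exists q1, b, q2; have -> : e = d.1 by apply: val_inj.
rewrite -dE2 -surjective_pairing /=.
rewrite -qE; split=> // a e' b' c qE'; apply: (rp (mw a) (val e') b' (mw c)).
by rewrite -qp qE' /map_walk map_cat.
Qed.

Lemma folded_core G : folded G -> folded (core G).
Proof.
move=> fG e1 e2 l h; apply: val_inj; apply: fG => //.
by case: h => /(congr1 val); [left|right].
Qed.

End Core.

(** * Schreier graphs and their cores *)

Section SchreierGraphs.
Variables (k : nat) (F : groupType) (X : 'I_k -> F).
Implicit Types (G : pgraph k) (H : set F).

Lemma core_like_core G : folded G -> core_like X (core G).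
Proof.
move=> fG; split; [exact: folded_core| |exact: core_core_edges].
move=> v; have [p wp] := connected_core v.
by exists (word_val X (wlab p)), p.
Qed.

Lemma coset_shiftM x y (C : set F) :
  coset_shift y (coset_shift x C) = coset_shift (x * y) C.
Proof.
rewrite /coset_shift image_comp; apply: eq_imagel => h _ /=.
by rewrite mulgA.
Qed.

Lemma coset_shift1 (C : set F) : coset_shift 1 C = C.
Proof.
by rewrite -[RHS]image_id; apply: eq_imagel => h _ /=; rewrite mulg1.
Qed.

Lemma folded_schreier H : folded (schreier X H).
Proof.
move=> [C i] [C' i'] /= iE; rewrite -{}iE => -[->|] //.
move=> /(congr1 val) /= /(congr1 (coset_shift (X i)^-1)).
by rewrite !coset_shiftM mulgV !coset_shift1 => /val_inj ->.
Qed.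

Lemma schreier_walk_val H (x : vert (schreier X H)) p y : walk x p y ->
  val y = coset_shift (word_val X (wlab p)) (val x).
Proof.
elim: p x => [|[[C i] b] p IH] x /=; first by move=> ->; rewrite word_val0 coset_shift1.
move=> [<- /IH ->]; rewrite word_val_cons -coset_shiftM; congr coset_shift.
case: b; rewrite /src /tgt /letter_val //=.
by rewrite coset_shiftM mulgV coset_shift1.
Qed.

Lemma schreier_walk H (x : vert (schreier X H)) w :
  exists p y, walk x p y /\ wlab p = w.
Proof.
elim: w x => [|[i b] w IH] x; first by exists [::], x.
have [d [sd ld]] : exists d : edge (schreier X H) * bool,
    src d = x /\ (lab d.1, d.2) = (i, b).
  case: b; first by exists ((x, i), true).
  exists ((SigSub (right_cosets_shift x (X i)^-1), i), false); split=> //.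
  by apply: val_inj; rewrite /src /= coset_shiftM mulVg coset_shift1.
have [p [y [wp <-]]] := IH (tgt d).
by exists (d :: p), y; rewrite /= ld.
Qed.

Hypothesis hX : free_basis X [set: F].

Lemma word_of g : exists2 w, reduced_word w & word_val X w = g.
Proof. by case: hX => _ _ /(_ g I)[w rw <-]; exists w. Qed.

Lemma pi_schreier H : is_subgroup H -> pi X (schreier X H) = H.
Proof.
move=> [H1 HM HV]; apply/seteqP; split=> [g [p [/schreier_walk_val e <-]]|g Hg].
  have : coset_shift (word_val X (wlab p)) H (word_val X (wlab p)).
    by exists 1; rewrite ?mul1g.
  by rewrite /= in e; rewrite -e.
have [w _ wg] := word_of g.
have [p [y [wp pw]]] := schreier_walk (base : vert (schreier X H)) w.
exists p; rewrite pw; split=> //; suff yb : y = base by rewrite yb in wp.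
apply: val_inj; rewrite (schreier_walk_val wp) pw wg /=.
apply/seteqP; split=> [_ [h Hh <-]|h Hh]; first exact: HM.
by exists (h * g^-1); [apply: HM => //; exact: HV|rewrite mulgVK].
Qed.

Lemma pi_core G : folded G -> pi X (core G) = pi X G.
Proof.
move=> fG; apply/seteqP; split=> [|g].
  exact: (pi_map (core_val_morphism G)).
move=> /(reach_word fG)[p [wp rp <-]].
have cp := walk_core_edges wp (reduced_wlab rp).
have [q [z [wq zb qp]]] := walk_core (x := base) wp cp.
exists q; rewrite -qp (wlab_map (core_val_morphism G)); split=> //.
by have zE : z = base; [apply: val_inj|rewrite zE in wq].
Qed.

Lemma core_like_core_graph H : core_like X (core_graph X H).
Proof. exact/core_like_core/folded_schreier. Qed.

Lemma pi_core_graph H : is_subgroup H -> pi X (core_graph X H) = H.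
Proof. by move=> sH; rewrite pi_core ?pi_schreier //; exact: folded_schreier. Qed.

(** In a folded graph a reduced walk has a reduced label; morphisms preserve labels, and a reduced
    label forces the image walk to be reduced. *)
Lemma core_edges_map G G' (fv : vert G -> vert G') fe e :
  folded G -> morphism fv fe -> core_edges e -> core_edges (fe e).
Proof.
move=> fG f [p1 [b [p2 [wp rp]]]].
exists (map_walk fe p1), b, (map_walk fe p2).
have -> : map_walk fe p1 ++ (fe e, b) :: map_walk fe p2 =
    map_walk fe (p1 ++ (e, b) :: p2) by rewrite /map_walk map_cat.
split; first by have := walk_map f wp; case: f => ->.
by apply: reduced_wlab; rewrite (wlab_map f); exact: wlab_reduced wp rp.
Qed.

Lemma core_corestrict G G' (fv : vert G -> vert G') fe :
  core_like X G -> morphism fv fe ->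
  exists fv' fe', morphism (G := G) (G' := core G') fv' fe'.
Proof.
move=> [fG cG coreG] f; have [fb fo ft fl] := f.
have ce e : fe e \in core_edges (G := G').
  by apply/mem_set/(core_edges_map fG f).
have cv v : fv v \in core_verts (G := G').
  have [g [p [wp _]]] := cG v.
  case/lastP: p wp => [<-|p [e b]]; first by rewrite fb; exact: core_base.
  rewrite walk_rcons => -[_ <-]; apply/mem_set; right; exists (fe e).
  rewrite fo ft; split; first exact: set_mem.
  by rewrite /tgt /=; case: (b); [right|left].
exists (fun v => SigSub (cv v)), (fun e => SigSub (ce e)).
split=> [|e|e|e]; [|by apply: val_inj; exact: fo|by apply: val_inj; exact: ft|exact: fl].
by apply: val_inj; exact: fb.
Qed.

Lemma core_like_is_core_graph G : core_like X G -> is_core_graph X G.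
Proof.
move=> cG; have [fG conG _] := cG; pose L := pi X G.
have sL : is_subgroup L by exact: is_subgroup_pi.
exists L; split=> //.
(* The vertex [v] corresponds to the coset of all values of walks from the base to [v]. *)
have coset (v : vert G) : [set g | reach X base g v] \in right_cosets L.
  apply/mem_set; have [w hw] := conG v; exists w.
  apply/seteqP; split=> [g /= hg|_ [h Lh <-]]; last exact: reach_trans hw.
  exists (g * w^-1); last by rewrite mulgVK.
  exact: reach_trans (reach_sym hw).
pose fv v : vert (schreier X L) := SigSub (coset v).
pose fe (e : edge G) : edge (schreier X L) := (fv (org e), lab e).
have f : morphism fv fe.
  split=> // [|e]; first exact: val_inj.
  apply: val_inj; rewrite /= /coset_shift; apply/seteqP; split=> [_ [g hg <-]|g hg].
    exact: reach_trans hg (reach_edge _ _).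
  exists (g * (X (lab e))^-1); last by rewrite mulgVK.
  exact: reach_trans hg (reach_sym (reach_edge _ _)).
have [fv' [fe' f']] := core_corestrict cG f.
apply: (iso_of_morphism hX fG conG _ f').
  exact: core_like_core_graph.
by rewrite pi_core_graph.
Qed.

Lemma iso_refl G : iso G G.
Proof. by exists id, id; split=> //; exists id. Qed.

Lemma iso_sym G G' : iso G G' -> iso G' G.
Proof.
move=> [fv [fe [[fb fo ft fl] [gv vK Kv] [ge eK Ke]]]].
exists gv, ge; split; [|by exists fv|by exists fe].
split=> [|e|e|e]; first by rewrite -fb vK.
- by rewrite -{2}[e]Ke fo vK.
- by rewrite -{2}[e]Ke ft vK.
- by rewrite -{2}[e]Ke fl.
Qed.

Lemma iso_surjective G G' : iso G G' ->
  exists (fv : vert G -> vert G') fe, surjective_morphism fv fe.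
Proof.
move=> [fv [fe [f [gv vK Kv] [ge eK Ke]]]]; exists fv, fe; split=> // y _.
  by exists (gv y).
by exists (ge y).
Qed.

Lemma pi_iso G G' : iso G G' -> pi X G = pi X G'.
Proof.
move=> h; apply/seteqP; split.
  by have [fv [fe [f _ _]]] := h; exact: pi_map f.
by have [fv [fe [f _ _]]] := iso_sym h; exact: pi_map f.
Qed.

Lemma is_core_graph_connected G : is_core_graph X G -> connected X G.
Proof.
move=> [L [_ /iso_sym/iso_surjective[fv [fe f]]]]; apply: connected_map f _.
by have [] := core_like_core_graph L.
Qed.

Lemma list_sub (T : Type) (A : set T) (s : seq T) :
  exists s' : seq A, forall a : A, List.In (val a) s -> List.In a s'.
Proof.
elim: s => [|x s [s' IH]]; first by exists [::].
have [xA|xA] := boolP (x \in A).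
  exists (SigSub xA :: s') => a /= [xa|/IH]; [left|by right].
  by apply: val_inj.
exists s' => a /= [xa|/IH //]; case/negP: xA; rewrite xa; exact: valP.
Qed.

(** Choose closed walks in the Schreier graph for the generators and let [D] list their edges. Every
    element of [H] is then read inside [D], and reduction stays inside [D]; the reduced closed walk
    with a given value being unique, all core edges lie in [D]. *)
Lemma finite_core_graph H : is_subgroup H -> fin_gen H ->
  finite_edges (core_graph X H).
Proof.
move=> sH [n [g Hg]]; pose S := schreier X H.
have fS : folded S by exact: folded_schreier.
have /choice[P PE] : forall j, exists p, walk (base : vert S) p base /\
    word_val X (wlab p) = g j.
  by move=> j; have := range_gen g j; rewrite -Hg -{1}(pi_schreier sH).
pose D := flatten [seq [seq d.1 | d <- P j] | j <- enum 'I_n].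
have PD j : List.Forall (fun d => List.In d.1 D) (P j).
  apply/List.Forall_forall => d dP.
  apply: (In_flatten_map (mem_enum _ j)); exact: (List.in_map fst).
have HD h : H h -> exists p, [/\ walk (base : vert S) p base,
    word_val X (wlab p) = h & List.Forall (fun d => List.In d.1 D) p].
  rewrite Hg => -[w _ <-]; elim: w => [|[j b] w [p [wp pv pD]]].
    by exists [::]; rewrite !word_val0.
  have [wj vj] := PE j.
  exists ((if b then P j else rev_walk (P j)) ++ p); split.
  - apply/walk_cat; exists base; split=> //.
    by case: b; [|apply: walk_rev].
  - rewrite wlab_cat word_val_cat pv word_val_cons; congr (_ * _).
    by rewrite /letter_val; case: b => //=; rewrite word_val_rev vj.
  - apply/Forall_cat; split=> //; case: b => //.
    exact: (Forall_rev_walk (P := fun e => List.In e D)).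
have [s sE] := list_sub (core_edges (G := S)) D; exists s => e; apply: sE.
have [p1 [b [p2]]] := set_mem (valP e).
set p := p1 ++ _ => -[wp rp].
have [|q [wq' vq qD]] := HD (word_val X (wlab p)).
  have : pi X S (word_val X (wlab p)) by exists p.
  by rewrite /S pi_schreier.
have [q' [wr rq' vq' qD']] := reduce_walk fS wq'.
have [q'p _] : q' = p /\ base = base :> vert S.
  apply: (walk_det _ wr wp); first exact: fS.
  apply: (reduced_eq hX) => //; first exact: wlab_reduced wp rp.
  by rewrite -vq !word_val_wlab.
have := qD' (fun e => List.In e D) qD; rewrite q'p.
move=> /List.Forall_forall/(_ (val e, b)); apply.
exact: List.in_elt.
Qed.

End SchreierGraphs.

(** * The Nielsen-Schreier theorem *)

Section NielsenSchreier.
Variables (k : nat) (F : groupType) (X : 'I_k -> F).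
Hypothesis hX : free_basis X [set: F].
Implicit Types G : pgraph k.

(** The tree is encoded by its paths [q v] from the base. The parent step of [v] is the last step of
    a shortest walk to [v], so the distance to the base drops by one along it. *)
Lemma spanning_tree G : connected X G ->
  exists2 q : vert G -> seq (edge G * bool), q base = [::] & forall v,
    walk base (q v) v /\
    (q v = [::] \/ exists d, tgt d = v /\ q v = rcons (q (src d)) d).
Proof.
move=> cG.
have ex (v : vert G) : exists n, `[< exists2 p, walk base p v & size p = n >].
  by have [g [p [wp _]]] := cG v; exists (size p); apply/asboolP; exists p.
pose dist v := ex_minn (ex v).
have distP v : exists2 p, walk base p v & size p = dist v.
  by rewrite /dist; case: ex_minnP => n /asboolP.
have dist_min v p : walk base p v -> (dist v <= size p)%N.
  move=> wp; rewrite /dist; case: ex_minnP => n _; apply.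
  by apply/asboolP; exists p.
have /choice[par parP] : forall v : vert G, exists d : option (edge G * bool),
    if dist v is n.+1 then exists d0, [/\ d = Some d0, tgt d0 = v & dist (src d0) = n]
    else d = None /\ v = base.
  move=> v; have [p wp sp] := distP v.
  case/lastP: p wp sp => [<- <-|p d wpd]; first by exists None.
  rewrite size_rcons => sp; rewrite -sp; exists (Some d), d.
  move: wpd; rewrite walk_rcons => -[wp tv]; split=> //.
  apply/eqP; rewrite eqn_leq dist_min //=.
  have [p' wp' <-] := distP (src d); rewrite -ltnS sp -(size_rcons p' d).
  by apply: dist_min; rewrite walk_rcons.
(* Following parent steps is not structural recursion, so [n] serves as fuel; [dist v] is the exact
   amount. *)
pose fix Q n v {struct n} := if n is n'.+1 then
  (if par v is Some d then rcons (Q n' (src d)) d else [::]) else [::].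
have d0 : dist base = 0 by apply/eqP; rewrite -leqn0 (dist_min _ [::]).
exists (fun v => Q (dist v) v) => [|v]; first by rewrite d0.
have [n nE] := ubnP (dist v); elim: n v nE => // n IH v nE.
have := parP v; case dE: (dist v) => [|m]; first by case=> _ ->; split=> //; left.
case=> d [pE tv sd]; rewrite /= pE; split; last by right; exists d; rewrite sd.
rewrite walk_rcons; split=> //; rewrite -sd; apply: (IH _ _).1.
by rewrite sd; rewrite dE in nE.
Qed.

(** The basis consists of the loops [y e], which go through the tree to an edge [e] outside it,
    cross [e] and return through the tree. A relation between them lifts to a closed walk that
    reduces to the empty one, so it is trivial under every evaluation of edges that is 1 on the
    tree. *)
Lemma nielsen_schreier G : finite_edges G -> folded G -> connected X G ->
  exists n (b : 'I_n -> F), free_basis b (pi X G).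
Proof.
move=> [s sE] fG cG; have [q q0 qP] := spanning_tree cG.
have qw v : walk base (q v) v by case: (qP v).
pose T e := exists d, d.1 = e /\ q (tgt d) = rcons (q (src d)) d.
have qT v : List.Forall (fun d => T d.1) (q v).
  have [n] := ubnP (size (q v)); elim: n v => // n IH v.
  case: (qP v) => _ [->|[d [tv qv]]]; first by constructor.
  rewrite qv size_rcons ltnS => /IH h; rewrite -cats1; apply/Forall_cat.
  by split=> //; constructor=> //; exists d; rewrite tv.
pose c v := word_val X (wlab (q v)).
have c_step d : c (src d) * letter_val X (lab d.1, d.2) * (c (tgt d))^-1 =
    if d.2 then c (org d.1) * X (lab d.1) * (c (ter d.1))^-1
    else (c (org d.1) * X (lab d.1) * (c (ter d.1))^-1)^-1.
  by case: d => e []; rewrite /src /tgt /letter_val //= !invgM invgK mulgA.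
pose y e := c (org e) * X (lab e) * (c (ter e))^-1.
have yT e : T e -> y e = 1.
  move=> [d [de qd]]; have := c_step d; rewrite {2}/c qd -cats1 wlab_cat.
  rewrite word_val_cat word_val1 -/(c _) mulgV de -/(y e).
  by case: (d.2) => [->//|/esym/eqP]; rewrite invg_eq1 => /eqP.
(* The classical structure supplies the decidable equality that [undup] and [index] require. *)
pose E : choiceType := {classic (edge G)}.
pose l : seq E := undup [seq e : E <- (s : seq E) | ~~ `[< T e >]].
have lE (e : E) : (e \in l) = ~~ `[< T e >].
  by rewrite mem_undup mem_filter (_ : e \in (s : seq E)) ?andbT //; apply/In_mem.
pose b (i : 'I_(size l)) := y (tnth (in_tuple l) i).
exists (size l), b.
have yb e : range (word_val b) (y e).
  have [Te|nTe] := pselect (T e); first by rewrite yT //; exists [::]; rewrite ?word_val0.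
  have /tnthP[i ei] : (e : E) \in in_tuple l by rewrite lE; apply/asboolPn.
  by exists [:: (i, true)] => //; rewrite word_val1 /letter_val /b /= -ei.
have [rb1 rbM rbV] := is_subgroup_range b.
have c_base : c base = 1 by rewrite /c q0 word_val0.
apply/free_basisP; split; last first.
- move=> w rw w1; apply: reduced_perm_trivial => // N t.
  (* [th] takes the value [t i] on the [i]-th edge outside the tree and 1 on tree edges, which are
     not in [l]. *)
  pose th (e : edge G) := oapp t 1 (insub (index (e : E) l)).
  have thT e : T e -> th e = 1.
    move=> Te; rewrite /th insubN // -leqNgt leqNgt index_mem lE.
    by rewrite negbK; apply/asboolP.
  have thq v : walk_val th (q v) = 1.
    elim: (q v) (qT v) => [|d p IH]; first by rewrite walk_val_nil.
    move/List.Forall_cons_iff=> [/thT td /IH].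
    by rewrite walk_val_cons td => ->; case: ifP; rewrite ?invg1 mulg1.
  have [p [wp vp tp]] : exists p : seq (edge G * bool), [/\ walk base p base,
      word_val X (wlab p) = word_val b w & walk_val th p = word_val t w].
    elim: w {rw w1} => [|[i e] w [p [wp vp tp]]].
      by exists [::]; rewrite !word_val0 walk_val_nil.
    pose ei := tnth (in_tuple l) i.
    pose p0 := q (org ei) ++ (ei, true) :: rev_walk (q (ter ei)).
    have wp0 : walk base p0 base.
      apply/walk_cat; exists (org ei); split=> //=; split=> //.
      exact: walk_rev.
    have vp0 : word_val X (wlab p0) = b i.
      rewrite wlab_cat word_val_cat /= word_val_cons word_val_rev.
      by rewrite mulgA.
    have tp0 : walk_val th p0 = t i.
      rewrite walk_val_cat walk_val_cons walk_val_rev !thq invg1 mulg1 mul1g /=.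
      rewrite /th /ei (tnth_nth (tnth (in_tuple l) i)) index_uniq ?undup_uniq //.
      by rewrite valK.
    exists ((if e then p0 else rev_walk p0) ++ p); split.
    + apply/walk_cat; exists base; split=> //.
      by case: e; [|apply: walk_rev].
    + rewrite wlab_cat word_val_cat vp word_val_cons; congr (_ * _).
      rewrite /letter_val; case: e => //=.
      by rewrite word_val_rev vp0.
    + rewrite walk_val_cat tp word_val_cons; congr (_ * _).
      by rewrite /letter_val; case: e => //=; rewrite walk_val_rev tp0.
  have [p' [wp' rp' vp' _]] := reduce_walk fG wp.
  have p'0 : wlab p' = [::].
    apply: (reduced_eq hX) => //.
    by rewrite word_val0 word_val_wlab vp' -word_val_wlab vp.
  by rewrite -tp -vp'; case: (p') p'0 => // _; rewrite walk_val_nil.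
apply/seteqP; split=> [g [p [wp <-]]|].
  (* Closing up each prefix of a walk through the tree makes the product telescope into factors
     [y e] and their inverses. *)
  have main v : walk base p v -> range (word_val b) (word_val X (wlab p) * (c v)^-1).
    elim/last_ind: p v {wp} => [|p d IH] v.
      by move=> /= <-; rewrite c_base word_val0 mulgV.
    rewrite walk_rcons => -[/IH h <-]; rewrite -cats1 wlab_cat word_val_cat word_val1.
    have -> : word_val X (wlab p) * letter_val X (lab d.1, d.2) * (c (tgt d))^-1 =
      (word_val X (wlab p) * (c (src d))^-1) *
      (c (src d) * letter_val X (lab d.1, d.2) * (c (tgt d))^-1).
      by rewrite !mulgA mulgVK.
    apply: rbM => //; rewrite c_step -/(y _); case: ifP => _; first exact: yb.
    exact/rbV.
  by have := main _ wp; rewrite c_base invg1 mulg1.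
apply: range_sub; first exact: is_subgroup_pi.
move=> i; rewrite /pi /= /b /y; set e := tnth _ _.
have rq v : reach X base (c v) v by exists (q v).
exact: reach_trans (reach_trans (rq _) (reach_edge _ _)) (reach_sym (rq _)).
Qed.

End NielsenSchreier.

(** * Folding *)

Section Quotients.
Variable k : nat.
Implicit Types G : pgraph k.

(** Fixed points of [rv] and [re] serve as representatives of the classes, so the quotient is built
    on subtypes. *)
Lemma idempotent_quotient G (rv : vert G -> vert G) (re : edge G -> edge G) :
  (forall x, rv (rv x) = rv x) -> (forall e, re (re e) = re e) ->
  (forall e, rv (org (re e)) = rv (org e)) ->
  (forall e, rv (ter (re e)) = rv (ter e)) ->
  (forall e, lab (re e) = lab e) ->
  exists G', quotient_by (fun x y => rv x = rv y) (fun e e' => re e = re e') G'.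
Proof.
move=> rvK reK rvo rvt rel.
pose A := [set x | rv x = x]; pose B := [set e | re e = e].
have rA x : rv x \in A by exact/mem_set/rvK.
have rB e : re e \in B by exact/mem_set/reK.
pose fv x : A := SigSub (rA x); pose fe e : B := SigSub (rB e).
have fvK (x : A) : fv (val x) = x by apply: val_inj; exact: set_valP x.
have feK (e : B) : fe (val e) = e by apply: val_inj; exact: set_valP e.
have fv_eq x y : rv x = rv y -> fv x = fv y by move=> xy; exact: val_inj.
have fe_eq e e' : re e = re e' -> fe e = fe e' by move=> ee; exact: val_inj.
exists (@PGraph k A B (fun e => fv (org (val e))) (fun e => fv (ter (val e)))
  (fun e => lab (val e)) (fv base)), fv, fe.
split; [split; [split=> // e| |]|move=> x y|move=> e e'].
- by apply: val_inj; exact: rvo.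
- by apply: val_inj; exact: rvt.
- by move=> x _; exists (val x) => //; exact: fvK.
- by move=> e _; exists (val e) => //; exact: feK.
- by split=> [/(congr1 (val : A -> _))|xy] //; exact: fv_eq.
- by split=> [/(congr1 (val : B -> _))|ee] //; exact: fe_eq.
Qed.

Definition retract (T : Type) (a b x : T) := if pselect (x = b) then a else x.

Lemma retract_out T (a b : T) : retract a b b = a.
Proof. by rewrite /retract; case: pselect. Qed.

Lemma retract_id T (a b x : T) : x <> b -> retract a b x = x.
Proof. by rewrite /retract; case: pselect. Qed.

Lemma retract_in T (a b : T) : retract a b a = a.
Proof. by rewrite /retract; case: pselect. Qed.

Lemma retract_idem T (a b x : T) : retract a b (retract a b x) = retract a b x.
Proof.
have [->|xb] := pselect (x = b); first by rewrite retract_out retract_in.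
by rewrite !retract_id.
Qed.

Lemma retract_glue T (a b x y : T) : retract a b x = retract a b y <-> glue a b x y.
Proof.
split=> [|[->//|[-> ->]|[-> ->]]]; rewrite ?retract_in ?retract_out //.
have [->|xb] := pselect (x = b); have [->|yb] := pselect (y = b);
  rewrite ?retract_out ?retract_id //.
- by constructor 1.
- by constructor 3.
- by constructor 2.
- by constructor 1.
Qed.

Lemma quotient_by_eq G RV RV' RE RE' G' :
  (forall x y, RV x y <-> RV' x y) -> (forall e e', RE e e' <-> RE' e e') ->
  quotient_by (G := G) RV RE G' -> quotient_by RV' RE' G'.
Proof.
move=> hv he [fv [fe [f kv ke]]]; exists fv, fe.
by split=> // [x y|e e']; [rewrite kv|rewrite ke].
Qed.

Lemma merge_exists G (u v : vert G) : exists G', merge_vertices u v G'.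
Proof.
have [||||//|G' qG'] := @idempotent_quotient G (retract u v) id => //.
  exact: retract_idem.
by exists G'; apply: quotient_by_eq qG' => // x y; exact: retract_glue.
Qed.

Lemma factor_morphism G G' Gam (fv : vert G -> vert G') fe
    (gv : vert G -> vert Gam) ge :
  surjective_morphism fv fe -> morphism gv ge ->
  (forall x y, fv x = fv y -> gv x = gv y) ->
  (forall e e', fe e = fe e' -> ge e = ge e') ->
  exists gv' ge', [/\ morphism gv' ge', forall x, gv' (fv x) = gv x &
    forall e, ge' (fe e) = ge e].
Proof.
move=> [[fb fo ft fl] sv se] [gb go gt gl] kv ke.
have /choice[sv' svK] : forall y, exists x, fv x = y.
  by move=> y; have [x] := sv y I; exists x.
have /choice[se' seK] : forall y, exists x, fe x = y.
  by move=> y; have [x] := se y I; exists x.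
exists (gv \o sv'), (ge \o se'); split=> /= [|x|e]; last first.
- by apply: ke; rewrite seK.
- by apply: kv; rewrite svK.
split=> [|e|e|e] /=.
- by rewrite -gb; apply: kv; rewrite svK fb.
- by rewrite go; apply: kv; rewrite svK -fo seK.
- by rewrite gt; apply: kv; rewrite svK -ft seK.
- by rewrite gl -fl seK.
Qed.

Lemma morphism_comp G1 G2 G3 (fv : vert G1 -> vert G2) fe
    (gv : vert G2 -> vert G3) ge :
  morphism fv fe -> morphism gv ge -> morphism (gv \o fv) (ge \o fe).
Proof.
move=> [fb fo ft fl] [gb go gt gl]; split=> [|e|e|e] /=.
- by rewrite fb gb.
- by rewrite go fo.
- by rewrite gt ft.
- by rewrite gl fl.
Qed.

Lemma surjective_morphism_comp G1 G2 G3 (fv : vert G1 -> vert G2) fe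
    (gv : vert G2 -> vert G3) ge :
  surjective_morphism fv fe -> surjective_morphism gv ge ->
  surjective_morphism (gv \o fv) (ge \o fe).
Proof.
move=> [f sv se] [g tv te]; split; first exact: morphism_comp.
- by move=> z _; have [y _ <-] := tv z I; have [x _ <-] := sv y I; exists x.
- by move=> z _; have [y _ <-] := te z I; have [x _ <-] := se y I; exists x.
Qed.

Lemma surjective_morphism_id G : surjective_morphism (@id (vert G)) id.
Proof. by split=> // y _; exists y. Qed.

Lemma surjective_cancel G1 G2 G3 (fv : vert G1 -> vert G2) fe
    (gv : vert G2 -> vert G3) ge hv he :
  morphism gv ge -> @surjective_morphism _ G1 G3 hv he ->
  (forall x, gv (fv x) = hv x) -> (forall e, ge (fe e) = he e) ->
  surjective_morphism gv ge.
Proof.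
move=> g [_ sv se] kv ke; split=> // z _.
- by have [x _ <-] := sv z I; exists (fv x).
- by have [x _ <-] := se z I; exists (fe x).
Qed.

Lemma finite_edges_map G G' (fv : vert G -> vert G') fe :
  surjective_morphism fv fe -> finite_edges G -> finite_edges G'.
Proof.
move=> [_ _ se] [s sE]; exists (map fe s) => e'.
by have [e _ <-] := se e' I; apply: (List.in_map fe).
Qed.

(** Naming the merged endpoints [a] and [b] lets folds at origins and at termini be treated
    alike. *)
Lemma fold_exists G (e1 e2 : edge G) : e1 <> e2 -> lab e1 = lab e2 ->
  org e1 = org e2 \/ ter e1 = ter e2 ->
  exists a b G', [/\ fold_step G G', quotient_by (glue a b) (glue e1 e2) G' &
    (a = ter e1 /\ b = ter e2 /\ org e1 = org e2) \/
    (a = org e1 /\ b = org e2 /\ ter e1 = ter e2)].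
Proof.
move=> ne l.
have main a b : (a = ter e1 /\ b = ter e2 /\ org e1 = org e2) \/
    (a = org e1 /\ b = org e2 /\ ter e1 = ter e2) ->
  exists a b G', [/\ fold_step G G', quotient_by (glue a b) (glue e1 e2) G' &
    (a = ter e1 /\ b = ter e2 /\ org e1 = org e2) \/
    (a = org e1 /\ b = org e2 /\ ter e1 = ter e2)].
  move=> h.
  have ho e : retract a b (org (retract e1 e2 e)) = retract a b (org e).
    have [->|ne2] := pselect (e = e2); last by rewrite (retract_id _ ne2).
    rewrite retract_out.
    by case: h => [[_ [_ ->]]|[<- [<- _]]] //; rewrite retract_out retract_in.
  have ht e : retract a b (ter (retract e1 e2 e)) = retract a b (ter e).
    have [->|ne2] := pselect (e = e2); last by rewrite (retract_id _ ne2).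
    rewrite retract_out.
    by case: h => [[<- [<- _]]|[_ [_ ->]]] //; rewrite retract_out retract_in.
  have hl e : lab (retract e1 e2 e) = lab e.
    have [->|ne2] := pselect (e = e2); last by rewrite (retract_id _ ne2).
    by rewrite retract_out.
  have [G' /(quotient_by_eq (retract_glue a b) (retract_glue e1 e2)) qG'] :=
    idempotent_quotient (retract_idem a b) (retract_idem e1 e2) ho ht hl.
  exists a, b, G'; split=> //; exists e1, e2; split=> //.
  by case: h => [[ha [hb hc]]|[ha [hb hc]]]; [left|right]; rewrite -ha -hb.
case=> h; first by apply: (main (ter e1) (ter e2)); left.
by apply: (main (org e1) (org e2)); right.
Qed.

(** Each fold merges two distinct edges and so shortens the covering list, which bounds the number
    of folds. As [Gam] is folded, the merged edges have the same image there and the morphism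
    descends. *)
Lemma fold_closure n G (s : seq (edge G)) Gam (gv : vert G -> vert Gam) ge :
  (size s < n)%N -> (forall e, List.In e s) -> folded Gam -> morphism gv ge ->
  exists G' (fv : vert G -> vert G') fe gv' ge',
    [/\ clos_refl_trans _ (@fold_step k) G G', folded G' &
    [/\ surjective_morphism fv fe, morphism gv' ge',
        forall x, gv' (fv x) = gv x & forall e, ge' (fe e) = ge e]].
Proof.
move=> + + fGam; elim: n G s gv ge => // n IH G s gv ge sn sE g.
have [fG|nfG] := pselect (folded G).
  exists G, id, id, gv, ge; split=> //; first exact: rt_refl.
  by split=> //; exact: surjective_morphism_id.
have [e1 [e2 [l h ne]]] : exists e1 e2 : edge G, [/\ lab e1 = lab e2,
    org e1 = org e2 \/ ter e1 = ter e2 & e1 <> e2].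
  apply: contrapT => H; apply: nfG => e1 e2 l h; apply: contrapT => ne.
  by apply: H; exists e1, e2.
have [a [b [G1 [stp [fv [fe [f kv ke]]] hab]]]] := fold_exists ne l h.
have [gb go gt gl] := g.
have g12 : ge e1 = ge e2.
  apply: fGam; first by rewrite !gl.
  by rewrite !go !gt; case: h => ->; [left|right].
have gab : gv a = gv b.
  by case: hab => [[-> [-> _]]|[-> [-> _]]]; rewrite -?gt -?go g12.
have [||g1v [g1e [g1 g1vK g1eK]]] := factor_morphism f g.
- by move=> x y /kv[->|[-> ->]|[-> ->]].
- by move=> x y /ke[->|[-> ->]|[-> ->]].
have [s1 [s2 sE12]] := In_split (sE e2).
have [||G' [f'v [f'e [g'v [g'e [rG' fG' [f' g' g'vK g'eK]]]]]]] :=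
  IH G1 (map fe (s1 ++ s2)) g1v g1e _ _ g1.
- by move: sn; rewrite sE12 size_map !size_cat /= addnS ltnS.
- move=> e'; have [_ _ se] := f; have [e _ <-] := se e' I.
  have {}e12 : fe e1 = fe e2 by apply/ke; constructor 2.
  have ins e0 : e0 <> e2 -> List.In (fe e0) (map fe (s1 ++ s2)).
    move=> ne0; apply: List.in_map; have := sE e0; rewrite sE12 !In_cat /=.
    by case=> [h1|[/esym//|h2]]; [left|right].
  by have [->|] := pselect (e = e2); [rewrite -e12|]; apply: ins.
exists G', (f'v \o fv), (f'e \o fe), g'v, g'e; split=> //.
  by apply: rt_trans rG'; apply: rt_step.
split=> // [|x|e]; first exact: surjective_morphism_comp f f'.
  by rewrite /= g'vK g1vK.
by rewrite /= g'eK g1eK.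
Qed.

(** * Closed-walk subgroups under quotients *)

Section Pi.
Variables (F : groupType) (X : 'I_k -> F).

Lemma immediate_quotient_exists G Gam (u v : vert G) (gv : vert G -> vert Gam) ge :
  core_like X G -> finite_edges G -> folded Gam -> surjective_morphism gv ge ->
  u <> v -> gv u = gv v ->
  exists G' (fv : vert G -> vert G') fe gv' ge',
    [/\ immediate_quotient G G', core_like X G' & finite_edges G'] /\
    [/\ surjective_morphism fv fe, fv u = fv v, surjective_morphism gv' ge' &
        forall x, gv' (fv x) = gv x].
Proof.
move=> [fG cG coreG] finG fGam g uv guv.
have [G0 mG0] := merge_exists u v; have [qv [qe [q kv ke]]] := mG0.
have [g0 gsv gse] := g.
have [||g1v [g1e [g1 g1vK g1eK]]] := factor_morphism q g0.
- by move=> x y /kv[->|[-> ->]|[-> ->]].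
- by move=> x y /ke ->.
have [s sE] := finite_edges_map q finG.
have [G' [fv [fe [g'v [g'e [rG' fG' [f g' g'vK g'eK]]]]]]] :=
  fold_closure (ltnSn _) sE fGam g1.
have qf := surjective_morphism_comp q f.
exists G', (fv \o qv), (fe \o qe), g'v, g'e; split; split.
- by exists u, v; split=> //; exists G0.
- split=> //; first exact: connected_map qf cG.
  have [qf0 _ se] := qf; move=> e'; have [e _ <-] := se e' I.
  exact: core_edges_map fG qf0 (coreG e).
- exact: finite_edges_map qf finG.
- exact: qf.
- by congr fv; apply/kv; constructor 2.
- by apply: (surjective_cancel g' g (fv := fv \o qv) (fe := fe \o qe)) => [x|e] /=;
    rewrite ?g'vK ?g'eK ?g1vK ?g1eK.
- by move=> x; rewrite /= g'vK g1vK.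
Qed.

(** The hypothesis puts into [L] the discrepancy of any two walks from the base whose ends are
    identified. A closed walk of [G'] lifts to [G] edge by edge, and the jump between consecutive
    lifts is such a discrepancy. *)
Lemma pi_quotient G G' (fv : vert G -> vert G') fe (L : set F) :
  surjective_morphism fv fe -> connected X G -> is_subgroup L ->
  (forall x y a b, fv x = fv y -> reach X base a x -> reach X base b y ->
    L (a * b^-1)) ->
  pi X G' `<=` L.
Proof.
move=> [f sv se] cG [L1 LM LV] kL g [p [wp <-]].
have main x' y' : walk x' p y' -> forall x y a b, fv x = x' -> fv y = y' ->
    reach X base a x -> reach X base b y -> L (a * word_val X (wlab p) * b^-1).
  elim: p x' {g wp} => [|[e' b] p IH] x' /=.
    move=> -> x y a c xE yE ra rc; rewrite word_val0 mulg1; apply: kL ra rc.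
    by rewrite xE yE.
  have [e _ <-] := se e' I; have [_ fo ft fl] := f.
  move=> [sd wp] x y a c xE yE ra rc.
  have [h rh] := cG (src (e, b)).
  have La : L (a * h^-1).
    by apply: kL ra rh; rewrite xE -sd; exact: src_map f (e, b).
  have rt : reach X base (h * letter_val X (lab e, b)) (tgt (e, b)).
    apply: reach_trans rh _; exists [:: (e, b)].
    by rewrite /= word_val1.
  have := IH _ wp _ y _ c _ yE rt rc.
  rewrite -(tgt_map f (e, b)) /= => /(_ erefl) Lt.
  have := LM _ _ La Lt; rewrite word_val_cons fl !mulgA.
  by rewrite mulgVK.
have fb : fv base = base by case: f.
have := main _ _ wp base base 1 1 fb fb (reach_refl _ _) (reach_refl _ _).
by rewrite mul1g invg1 mulg1.
Qed.

(** The two vertices merged by a fold are joined by a walk of value 1, so their identification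
    creates no new element. *)
Lemma pi_fold_step G G' : fold_step G G' -> connected X G ->
  connected X G' /\ pi X G' = pi X G.
Proof.
move=> [e1 [e2 [ne l h]]] cG.
have [a [b [[fv [fe [f kv _]]] rab]]] : exists a b,
    quotient_by (glue a b) (glue e1 e2) G' /\ reach X a 1 b.
  case: h => [[oo qG']|[tt qG']].
    exists (ter e1), (ter e2); split=> //.
    rewrite -(mulVg (X (lab e1))); apply: reach_trans (reach_sym (reach_edge _ _)) _.
    by rewrite oo l; exact: reach_edge.
  exists (org e1), (org e2); split=> //.
  rewrite -(mulgV (X (lab e1))); apply: reach_trans (reach_edge _ _) _.
  by rewrite tt l; exact: reach_sym (reach_edge _ _).
split; first exact: connected_map f cG.
apply/seteqP; split; last by case: f => f _ _; exact: pi_map f.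
apply: (pi_quotient f cG); first exact: is_subgroup_pi.
move=> x y c d /kv xy rc rd.
suff rxy : reach X x 1 y.
  have := reach_trans (reach_trans rc rxy) (reach_sym rd).
  by rewrite mulg1.
case: xy => [->|[-> ->]|[-> ->]] //; first exact: reach_refl.
by have := reach_sym rab; rewrite invg1.
Qed.

(** Merging [u] and [v] adds the loop [a * b^-1], where [a] and [b] reach [u] and [v]; the folds
    that follow change nothing. That [pi X G] and [z] generate is expressed through all subgroups
    [L] containing them. *)
Lemma pi_immediate_quotient G G' : immediate_quotient G G' -> connected X G ->
  [/\ connected X G', pi X G `<=` pi X G' & exists2 z, pi X G' z &
    forall L, is_subgroup L -> pi X G `<=` L -> L z -> pi X G' `<=` L].
Proof.
move=> [u [v [_ [G0 [[fv [fe [f kv _]]] rG' _]]]]] cG.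
have [h1 h2] : connected X G' /\ pi X G' = pi X G0.
  have := connected_map f cG; elim: rG' => {G' f kv fe fv}.
  - by move=> G1 G2 h; exact: pi_fold_step.
  - by [].
  - by move=> G1 G2 G3 _ IH1 _ IH2 /IH1[/IH2[c3 ->] ->].
rewrite h2; have [f0 sv se] := f; split=> //; first exact: pi_map f0.
have [a ra] := cG u; have [b rb] := cG v.
exists (a * b^-1).
  have fb : fv base = base by case: f0.
  have uv : fv u = fv v by apply/kv; constructor 2.
  move: (reach_map f0 ra) (reach_sym (reach_map f0 rb)).
  by rewrite fb uv => r1 r2; exact: reach_trans r1 r2.
move=> L [L1 LM LV] GL Lz; apply: (pi_quotient f cG) => // x y c d /kv xy rc rd.
have key (x0 : vert G) g h : reach X base g x0 -> reach X base h x0 -> L (g * h^-1).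
  by move=> rg rh; apply: GL; exact: reach_trans rg (reach_sym rh).
case: xy rc rd => [->|[-> ->]|[-> ->]] rc rd; first exact: key rc rd.
- have := LM _ _ (LM _ _ (key _ _ _ rc ra) Lz) (key _ _ _ rb rd).
  by rewrite !mulgA !mulgVK.
- have := LM _ _ (LM _ _ (key _ _ _ rc rb) (LV _ Lz)) (key _ _ _ ra rd).
  by rewrite invgF !mulgA !mulgVK.
Qed.

End Pi.
End Quotients.

(** * Attaching edges to a core graph *)

(* Otherwise the linear system [f u = f v], for the edges [(u, _, v)] of [E],
   would have a nonzero solution [f] vanishing outside [T]. *)
Lemma spanning_size (A L : Type) (T : finType) (E : seq ((A + T) * L * (A + T))) :
  (forall Q : A + T -> Prop, (forall a, Q (inl a)) ->
    (forall t, List.In t E -> (Q t.1.1 <-> Q t.2)) -> forall x, Q x) ->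
  (#|T| <= size E)%N.
Proof.
move=> spanE; rewrite leqNgt; apply/negP => lt.
(* Vertices of [T] get standard basis vectors, those of [A] get 0, and column [j] of [M] is the
   difference along edge [j]. With more rows than columns, [M] has a nonzero left kernel vector
   [v]. *)
pose ind (x : A + T) (i : 'I_#|T|) : rat :=
  (if x is inr y then (enum_val i == y)%:R else 0)%R.
pose M : 'M[rat]_(#|T|, size E) :=
  (\matrix_(i, j) (ind (tnth (in_tuple E) j).1.1 i - ind (tnth (in_tuple E) j).2 i))%R.
have : (kermx M != 0)%R.
  by rewrite kermx_eq0 /row_free ltn_eqF // (leq_ltn_trans (rank_leq_col _)).
case/rowV0Pn => v /sub_kermxP vM v0.
pose f x := (\sum_i v ord0 i * ind x i)%R.
have fE t : List.In t E -> f t.1.1 = f t.2.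
  move=> tE; have [j jE tj] : exists2 j, (j < size E)%N & nth t E j = t.
    by elim: (E) tE => //= t1 E1 IH [->|/IH[j ? ?]]; [exists 0|exists j.+1].
  move/matrixP/(_ ord0 (Ordinal jE)): vM; rewrite !mxE => /eqP.
  under eq_bigr do rewrite mxE (tnth_nth t) /= tj GRing.mulrBr.
  by rewrite GRing.sumrB GRing.subr_eq0 => /eqP.
have f0 : forall x, f x = 0%R.
  apply: spanE => [a|t /fE ->//].
  by rewrite /f big1 // => i _; rewrite GRing.mulr0.
case/negP: v0; apply/eqP/rowP => i; rewrite mxE -(f0 (inr (enum_val i))) /f.
rewrite (bigD1 i) //= eqxx GRing.mulr1 big1 ?GRing.addr0 // => j ji.
by rewrite (inj_eq enum_val_inj) (negPf ji) GRing.mulr0.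
Qed.

Section Attach.
Variables (k : nat) (F : groupType) (X : 'I_k -> F).
Implicit Types (S Gam : pgraph k) (T : finType).

Definition triple V := (V * 'I_k * V)%type.
Definition map_triple V V' (f : V -> V') (t : triple V) : triple V' :=
  (f t.1.1, t.1.2, f t.2).

(** Equal triples are one edge, so pushing [E] along a vertex map merges parallel edges by itself. A
    folded [S] loses no edge, its edges being determined by their triples. *)
Definition attached_edge S T (E : seq (triple (vert S + T))) :
    set (triple (vert S + T)) :=
  [set t | (exists e : edge S, t = (inl (org e), lab e, inl (ter e))) \/ List.In t E].

Definition attach S T (E : seq (triple (vert S + T))) : pgraph k :=
  @PGraph k (vert S + T)%type (attached_edge E)
    (fun t => (val t).1.1) (fun t => (val t).2) (fun t => (val t).1.2) (inl base).

Definition sum_map S T Gam (gv : vert S -> vert Gam) (h : T -> vert Gam)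
    (x : vert S + T) := match x with inl a => gv a | inr j => h j end.

Definition has_edge Gam (t : triple (vert Gam)) :=
  exists e : edge Gam, t = (org e, lab e, ter e).

(* The second condition is an induction principle saying that [E] connects every
   vertex of [T] to [S]. *)
Definition attached S T (E : seq (triple (vert S + T))) Gam (gv : vert S -> vert Gam)
    (h : T -> vert Gam) :=
  (forall t, List.In t E -> has_edge (map_triple (sum_map gv h) t)) /\
  (forall Q : vert S + T -> Prop, (forall a, Q (inl a)) ->
    (forall t, List.In t E -> (Q t.1.1 <-> Q t.2)) -> forall x, Q x).

Lemma attach_edge S T (E : seq (triple (vert S + T))) t : attached_edge E t ->
  exists e : edge (attach E), t = (org e, lab e, ter e).
Proof.
by move=> /mem_set h; exists (SigSub h : attached_edge E); case: t h => [[]].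
Qed.

Lemma attach_map S T E S' T' E' (phi : vert S + T -> vert S' + T') :
  phi (inl base) = inl base ->
  (forall t, @attached_edge S T E t -> @attached_edge S' T' E' (map_triple phi t)) ->
  exists fe, morphism (G := attach E) (G' := attach E') phi fe.
Proof.
move=> pb pE.
have /choice[fe feE] : forall e : edge (attach E), exists e' : edge (attach E'),
    map_triple phi (val e) = (org e', lab e', ter e').
  by move=> e; apply/attach_edge/pE; exact: set_valP.
by exists fe; split=> // e; case: (feE e).
Qed.

Lemma attach_inl S T (E : seq (triple (vert S + T))) :
  exists fe, morphism (G' := attach E) (@inl (vert S) T) fe.
Proof.
have /choice[fe feE] : forall e : edge S, exists e' : edge (attach E),
    (inl (org e), lab e, inl (ter e)) = (org e', lab e', ter e').
  by move=> e; apply: attach_edge; left; exists e.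
by exists fe; split=> // e; case: (feE e).
Qed.

Lemma has_edge_map S T (E : seq (triple (vert S + T))) Gam (gv : vert S -> vert Gam)
    ge h t : morphism gv ge -> attached E gv h -> attached_edge E t ->
  has_edge (map_triple (sum_map gv h) t).
Proof.
move=> [_ go gt gl] [hE _] [[e ->]|/hE //].
by exists (ge e); rewrite /map_triple /= go gt gl.
Qed.

(** Unlike [quotient_chain], this grows at its first graph, as the induction does, and asks for
    [core_like]. *)
Inductive chain Gam : pgraph k -> nat -> Prop :=
| chain_iso S : core_like X S -> iso S Gam -> chain Gam S 0
| chain_step S S' m : core_like X S -> immediate_quotient S S' ->
    chain Gam S' m -> chain Gam S m.+1.

Hypothesis hX : free_basis X [set: F].

(** If [a] and [a'] have the same image in [Gam], walks to them differ by an element of [pi X Gam],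
    hence by the value of a closed walk of [attach E]; determinism in this folded graph gives
    [a = a']. *)
Lemma folded_attach_iso S T (E : seq (triple (vert S + T))) Gam
    (gv : vert S -> vert Gam) ge :
  core_like X S -> surjective_morphism gv ge -> folded (attach E) ->
  pi X Gam `<=` pi X (attach E) -> iso S Gam.
Proof.
move=> [fS cS _] [g sv se] fA sub; have [gb go gt gl] := g.
have [ie im] := attach_inl E.
have gvI : injective gv.
  move=> a a' aa; have [p pa] := cS a; have [p' pa'] := cS a'.
  have : pi X Gam (p * p'^-1).
    move: (reach_map g pa) (reach_sym (reach_map g pa')).
    by rewrite gb aa => r1 r2; exact: reach_trans r1 r2.
  move=> /sub h; have := reach_trans h (reach_map im pa').
  by rewrite mulgVK => /(reach_det hX fA (reach_map im pa))[].
exists gv, ge; split=> //; apply: inj_surj_bijective => //.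
- by move=> y; have [x _ <-] := sv y Logic.I; exists x.
- move=> e e' ee; apply: fS; first by rewrite -!gl ee.
  by left; apply: gvI; rewrite -!go ee.
- by move=> y; have [x _ <-] := se y Logic.I; exists x.
Qed.

(* A failure of foldedness yields an attached edge [t2] made redundant by [t1]
   once the vertices [v1] and [v2] are identified. *)
Lemma unfolded_pair S T (E : seq (triple (vert S + T))) Gam
    (gv : vert S -> vert Gam) ge h :
  folded S -> folded Gam -> morphism gv ge -> attached E gv h ->
  ~ folded (attach E) ->
  exists t1 t2 v1 v2,
    [/\ attached_edge E t1, List.In t2 E, t1 <> t2, v1 <> v2 &
        sum_map gv h v1 = sum_map gv h v2 /\
        forall W (phi : vert S + T -> W), phi v1 = phi v2 ->
          map_triple phi t1 = map_triple phi t2].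
Proof.
move=> fS fG g aE nf.
have main t1 t2 : attached_edge E t1 -> List.In t2 E -> t1 <> t2 -> t1.1.2 = t2.1.2 ->
    t1.1.1 = t2.1.1 \/ t1.2 = t2.2 ->
    exists t1 t2 v1 v2,
    [/\ attached_edge E t1, List.In t2 E, t1 <> t2, v1 <> v2 &
        sum_map gv h v1 = sum_map gv h v2 /\
        forall W (phi : vert S + T -> W), phi v1 = phi v2 ->
          map_triple phi t1 = map_triple phi t2].
  move=> h1 h2 ne l ot; have h2' : attached_edge E t2 by right.
  have [e1 [o1 l1 r1]] := has_edge_map g aE h1.
  have [e2 [o2 l2 r2]] := has_edge_map g aE h2'.
  have ee : e1 = e2.
    apply: fG; first by rewrite -l1 -l2.
    by rewrite -o1 -o2 -r1 -r2; case: ot => ->; [left|right].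
  case: t1 t2 h1 h2 ne l ot o1 r1 o2 r2 {h2' l1 l2} => [[u1 i1] w1] [[u2 i2] w2] /=.
  move=> h1 h2 ne l ot o1 r1 o2 r2; rewrite -l in h2 ne *.
  case: ot => uE.
    exists (u1, i1, w1), (u2, i1, w2), w1, w2; split=> //.
      by move=> ww; apply: ne; rewrite uE ww.
    split=> [|W phi ww]; first by rewrite r1 r2 ee.
    by rewrite /map_triple /= uE ww.
  exists (u1, i1, w1), (u2, i1, w2), u1, u2; split=> //.
    by move=> ww; apply: ne; rewrite uE ww.
  split=> [|W phi ww]; first by rewrite o1 o2 ee.
  by rewrite /map_triple /= uE ww.
have [e1 [e2 [l ot ne]]] : exists e1 e2 : edge (attach E), [/\ lab e1 = lab e2,
    org e1 = org e2 \/ ter e1 = ter e2 & e1 <> e2].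
  by apply: contrapT => H; apply: nf => e1 e2 l ot; apply: contrapT => ne;
    apply: H; exists e1, e2.
have vne : val e1 <> val e2 by move=> /val_inj.
have [h1 h2] : attached_edge E (val e1) /\ attached_edge E (val e2).
  by split; exact: set_valP.
have [h2'|n2] := pselect (List.In (val e2) E); first exact: main h1 h2' vne l ot.
have [h1'|n1] := pselect (List.In (val e1) E).
  apply: main h2 h1' _ _ _; [by move/esym|by []|].
  by case: ot => ?; [left|right].
case: h1 h2 => [[a1 E1]|//] [[a2 E2]|//]; case: vne; rewrite E1 E2.
suff -> : a1 = a2 by [].
move: l ot; rewrite /= E1 E2 /= => l ot; apply: fS => //.
by case: ot => -[]; [left|right].
Qed.

(** Since [phi] sends [t1] and [t2] to the same triple, dropping [t2] loses no edge of the image, so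
    walks and connectedness survive. The lemma serves both when [phi] eliminates a vertex of [T] and
    when it comes from a quotient of [S]. *)
Lemma attached_quotient S T (E1 E2 : seq (triple (vert S + T))) t1 t2 Gam
    (gv : vert S -> vert Gam) h S' T' (qv : vert S -> vert S') qe
    (phi : vert S + T -> vert S' + T') (gv' : vert S' -> vert Gam) h' :
  attached_edge (E1 ++ t2 :: E2) t1 -> t1 <> t2 ->
  map_triple phi t1 = map_triple phi t2 ->
  morphism qv qe -> (forall a, phi (inl a) = inl (qv a)) ->
  (forall j, exists x, phi x = inr j) ->
  (forall x, sum_map gv' h' (phi x) = sum_map gv h x) ->
  attached (E1 ++ t2 :: E2) gv h ->
  attached (map (map_triple phi) (E1 ++ E2)) gv' h' /\
  pi X (attach (E1 ++ t2 :: E2)) `<=` pi X (attach (map (map_triple phi) (E1 ++ E2))).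
Proof.
move=> h1 ne12 p12 [qb qo qt ql] phil phir gphi [hE spanE].
set E' := map _ _.
have inE' t : List.In t (E1 ++ t2 :: E2) -> t <> t2 -> List.In (map_triple phi t) E'.
  move=> + ne; rewrite In_cat /= => tE; apply: List.in_map; apply/In_cat.
  by case: tE => [|[/esym//|]]; [left|right].
have edgeE' t : attached_edge (E1 ++ t2 :: E2) t -> attached_edge E' (map_triple phi t).
  have S_edge e : attached_edge E' (map_triple phi (inl (org e), lab e, inl (ter e))).
    by left; exists (qe e); rewrite /map_triple /= !phil qo qt ql.
  case=> [[e ->]|tE]; first exact: S_edge.
  have [t12|] := pselect (t = t2); last by right; apply: inE'.
  rewrite t12 -p12; case: h1 => [[e ->]|h1]; first exact: S_edge.
  by right; apply: inE'.
split; last first.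
  have [|fe f] := attach_map _ edgeE'; first by rewrite phil qb.
  exact: pi_map f.
split=> [t' /List.in_map_iff[t [<- tE]]|Q Ql QE x'].
  have [|e eE] := hE t.
    by apply/In_cat; move/In_cat: tE => [|]; [left|right; right].
  by exists e; rewrite -eE /map_triple /= !gphi.
have Qphi : forall x, Q (phi x).
  apply: spanE => [a|t tE]; first by rewrite phil.
  have [|e|tE'] := edgeE' t; first by right.
  - case: e => e; rewrite /map_triple => -[-> _ ->].
    by split=> _; apply: Ql.
  - exact: (QE (map_triple phi t)).
by case: x' => // j; have [x <-] := phir j.
Qed.

(** Induction on [size E]: each failure of foldedness costs one element of [E]. In the folded case
    the bound is [spanning_size]. *)
Lemma attached_chain Gam S T (E : seq (triple (vert S + T)))
    (gv : vert S -> vert Gam) ge h :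
  folded Gam ->
  core_like X S -> finite_edges S -> surjective_morphism gv ge ->
  attached E gv h -> pi X Gam `<=` pi X (attach E) ->
  exists m, (m + #|T| <= size E)%N /\ chain Gam S m.
Proof.
move=> fGam; have [n] := ubnP (size E); elim: n S T E gv ge h => // n IH.
move=> S T E gv ge h sE cS finS g aE subE.
have [fA|nfA] := pselect (folded (attach E)).
  exists 0; split; first by rewrite add0n; apply: spanning_size; case: aE.
  by apply: chain_iso => //; exact: folded_attach_iso cS g fA subE.
have [fS _ _] := cS; have [g0 _ _] := g.
have [t1 [t2 [v1 [v2 [h1 h2 ne v12 [gv12 p12]]]]]] := unfolded_pair fS fGam g0 aE nfA.
have [E1 [E2 EE]] := In_split h2; rewrite {}EE in aE subE h1 sE h2 nfA *.
have sE' V (f : _ -> V) : size (map f (E1 ++ E2)) = (size (E1 ++ t2 :: E2)).-1.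
  by rewrite size_map !size_cat /= addnS.
have sE0 : (0 < size (E1 ++ t2 :: E2))%N by rewrite size_cat /= addnS.
(* An attached vertex [j] is replaced by the vertex [w] identified with it; [T] and [E] each lose
   one element and [S] is untouched. *)
have subst w j : w <> inr j -> sum_map gv h w = sum_map gv h (inr j) ->
    (forall W (phi : vert S + T -> W), phi w = phi (inr j) ->
      map_triple phi t1 = map_triple phi t2) ->
    exists m, (m + #|T| <= size (E1 ++ t2 :: E2))%N /\ chain Gam S m.
  move=> wj gwj phit.
  pose T' : finType := {i : T | i != j}.
  have [w' w'w] : exists w' : vert S + T',
      w = match w' with inl a => inl a | inr i => inr (val i) end.
    case: w wj {gwj phit} => [a|i] wj; first by exists (inl a).
    have ij : i != j by apply/eqP => ij; apply: wj; rewrite ij.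
    by exists (inr (exist _ i ij)).
  pose phi (x : vert S + T) : vert S + T' := match x with
    | inl a => inl a
    | inr i => if insub i is Some i' then inr i' else w' end.
  have phi_val (i : T') : phi (inr (val i)) = inr i by rewrite /phi valK.
  have phi_j : phi (inr j) = w' by rewrite /phi insubN // eqxx.
  pose h' (i : T') := h (val i).
  have [||||||aE' subE'] := @attached_quotient S T E1 E2 t1 t2 Gam gv h S T'
      id id phi gv h' h1 ne.
  - by apply: phit; rewrite phi_j w'w; case: (w') => // i; rewrite phi_val.
  - by case: (surjective_morphism_id S).
  - by [].
  - by move=> i; exists (inr (val i)).
  - case=> // i; have [ij|ij] := eqVneq i j.
      rewrite ij phi_j -gwj w'w; by case: (w').
    by rewrite (_ : i = val (exist (fun i => i != j) i ij : T')) // phi_val.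
  - exact: aE.
  have cT : #|{: T'}| = #|T|.-1 by rewrite card_sig cardC1.
  have T0 : (0 < #|T|)%N by apply/card_gt0P; exists j.
  have [||m [mE cm]] := IH _ _ _ _ ge _ _ cS finS g aE'.
  - by rewrite sE'; lia.
  - exact: subset_trans subE subE'.
  by exists m; split=> //; move: mE; rewrite sE' cT; lia.
case: v1 v2 v12 gv12 p12 => [a1|j] [a2|j'] v12 gv12 p12.
(* Both vertices lie in [S]: an immediate quotient of [S] identifies them, paid for by one attached
   edge. *)
- have a12 : a1 <> a2 by move=> aa; apply: v12; rewrite aa.
  have [S' [qv [qe [gv' [ge' [[iq cS' finS'] [q quv g' g'K]]]]]]] :=
    immediate_quotient_exists cS finS fGam g a12 gv12.
  pose phi (x : vert S + T) : vert S' + T := match x with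
    | inl a => inl (qv a) | inr i => inr i end.
  have [q0 _ _] := q.
  have [|||||aE' subE'] := @attached_quotient S T E1 E2 t1 t2 Gam gv h S' T
      qv qe phi gv' h h1 ne _ q0.
  - by apply: p12; rewrite /phi quv.
  - by [].
  - by move=> i; exists (inr i).
  - by case=> // a; exact: g'K.
  - exact: aE.
  have [||m [mE cm]] := IH _ _ _ _ _ _ _ cS' finS' g' aE'.
  - by rewrite sE'; lia.
  - exact: subset_trans subE subE'.
  exists m.+1; split; last exact: chain_step cm.
  by move: mE; rewrite sE'; lia.
- exact: subst v12 gv12 p12.
- apply: subst (fun e => v12 (esym e)) (esym gv12) _ => W phi /esym; exact: p12.
- exact: subst v12 gv12 p12.
Qed.

End Attach.

(** * Chains of immediate quotients *)

Section Handles.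
Variables (k : nat) (F : groupType) (X : 'I_k -> F).
Variables (S Gam : pgraph k) (gv : vert S -> vert Gam).
Implicit Types T : finType.
Hypothesis gb : gv base = base.

Definition step_triple V (u : V) (l : 'I_k * bool) (v : V) : triple k V :=
  if l.2 then (u, l.1, v) else (v, l.1, u).

Lemma reach_step_triple G u l v :
  (exists e : edge G, step_triple u l v = (org e, lab e, ter e)) ->
  reach X u (letter_val X l) v.
Proof.
case: l => i [] [e [-> -> ->]]; first exact: reach_edge.
exact: reach_sym (reach_edge _ _).
Qed.

Lemma step_tripleE (d : edge Gam * bool) :
  step_triple (src d) (lab d.1, d.2) (tgt d) = (org d.1, lab d.1, ter d.1).
Proof. by case: d => e []. Qed.

Lemma map_step_triple V V' (f : V -> V') u l v :
  map_triple f (step_triple u l v) = step_triple (f u) l (f v).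
Proof. by case: l => i []. Qed.

(** The walk is copied step by step, each step adding the fresh vertex [None] of [option T] and one
    edge to it, so [size E] and [#|T|] grow equally. The last clause says that earlier walks
    survive. *)
Lemma attach_path T (E : seq (triple k (vert S + T))) h u p y :
  attached E gv h -> walk (sum_map gv h u) p y ->
  exists (T' : finType) (E' : seq (triple k (vert S + T'))) (h' : T' -> vert Gam)
      (phi : vert S + T -> vert S + T') u',
    [/\ attached E' gv h', (size E' + #|T| = size E + #|T'|)%N,
        forall a, phi (inl a) = inl a &
    [/\ sum_map gv h' u' = y,
        reach X (phi u : vert (attach E')) (word_val X (wlab p)) u' &
        forall x g z, reach X (x : vert (attach E)) g z ->
          reach X (phi x : vert (attach E')) g (phi z)]].
Proof.
elim: p T E h u => [|d p IH] T E h u aE /=.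
  move=> <-; exists T, E, h, id, u; split=> //; split=> //.
  by rewrite word_val0; exact: reach_refl.
move=> [sd wp]; have [hE spanE] := aE.
pose iota (x : vert S + T) : vert S + option T :=
  match x with inl a => inl a | inr j => inr (Some j) end.
pose h1 (j : option T) := if j is Some i then h i else tgt d.
pose t := step_triple (iota u) (lab d.1, d.2) (inr None : vert S + option T).
pose E1 := t :: map (map_triple iota) E.
have iotaE x : sum_map gv h1 (iota x) = sum_map gv h x by case: x.
have aE1 : attached E1 gv h1.
  split=> [t' [<-|/List.in_map_iff[t0 [<- /hE[e eE]]]]|Q Ql QE].
  - by exists d.1; rewrite map_step_triple iotaE -sd; exact: step_tripleE.
  - by exists e; rewrite -eE /map_triple /= !iotaE.
  have Qi : forall x, Q (iota x).
    apply: spanE => // t0 t0E; apply: (QE (map_triple iota t0)).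
    by right; exact: List.in_map.
  case=> // -[j|]; first exact: (Qi (inr j)).
  have := QE t (or_introl erefl); rewrite /t /step_triple.
  by case: (d.2) => /= -[h2 h3]; [apply: h2|apply: h3]; apply: Qi.
have [|fe f] := @attach_map _ S T E S (option T) E1 iota erefl.
  move=> t0 [[e ->]|tE]; first by left; exists e.
  by right; right; exact: (List.in_map (map_triple iota)).
have ru : reach X (iota u : vert (attach E1)) (letter_val X (lab d.1, d.2)) (inr None).
  apply: reach_step_triple; apply: attach_edge.
  by right; left.
have [T' [E' [h' [phi [u' [aE' sE' phil [yE rp rphi]]]]]]] := IH _ _ _ (inr None) aE1 wp.
exists T', E', h', (phi \o iota), u'; split=> //.
  by move: sE'; rewrite /= size_map card_option addnS addSn => -[].
split=> // [|x g z].
  by rewrite word_val_cons; exact: reach_trans (rphi _ _ _ ru) rp.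
by move=> r; apply: rphi; exact: reach_map f r.
Qed.

(** The last step closes up at the base without a fresh vertex, whence the 1; an empty walk attaches
    nothing, whence the inequality. *)
Lemma attach_handle T (E : seq (triple k (vert S + T))) h g :
  attached E gv h -> pi X Gam g ->
  exists (T' : finType) (E' : seq (triple k (vert S + T'))) (h' : T' -> vert Gam),
    [/\ attached E' gv h', (size E' + #|T| <= size E + #|T'| + 1)%N,
        pi X (attach E) `<=` pi X (attach E') & pi X (attach E') g].
Proof.
move=> aE [p [wp <-]]; case/lastP: p wp => [_|p d].
  exists T, E, h; split=> //; first exact: leq_addr.
  by rewrite word_val0; have [] := is_subgroup_pi X (attach E).
rewrite walk_rcons => -[wp td].
have [|T' [E' [h' [phi [u' [aE' sE' phil [yE rp rphi]]]]]]] :=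
    @attach_path T E h (inl base) p (src d) aE.
  by rewrite /= gb.
pose t := step_triple u' (lab d.1, d.2) (inl base : vert S + T').
have [fe f] : exists fe, morphism (G := attach E') (G' := attach (t :: E')) id fe.
  apply: attach_map => // t' [[e ->]|tE]; first by left; exists e.
  by right; right; case: t' tE => [[]].
exists T', (t :: E'), h'; split.
- split=> [t' [<-|/(aE'.1)//]|Q Ql QE].
    exists d.1; rewrite map_step_triple yE /= gb -td; exact: step_tripleE.
  by apply: aE'.2 => // t0 t0E; apply: QE; right.
- by rewrite /= addSn sE' addn1.
- move=> g' /rphi; rewrite phil => r.
  exact: reach_map f r.
have rd : reach X (u' : vert (attach (t :: E'))) (letter_val X (lab d.1, d.2)) base.
  apply: reach_step_triple; apply: attach_edge.
  by right; left.
rewrite phil in rp; rewrite -cats1 wlab_cat word_val_cat word_val1.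
exact: reach_trans (reach_map f rp) rd.
Qed.

Lemma attach_handles (s : seq F) : List.Forall (pi X Gam) s ->
  exists (T : finType) (E : seq (triple k (vert S + T))) (h : T -> vert Gam),
    [/\ attached E gv h, (size E <= size s + #|T|)%N,
        pi X S `<=` pi X (attach E) & List.Forall (pi X (attach E)) s].
Proof.
elim: s => [_|g s IH /List.Forall_cons_iff[pg /IH[T [E [h [aE sE subE sS]]]]]].
  exists void, [::], (fun v : void => match v with end); split=> //.
  - by split=> [t []|Q Ql _ []].
  - have [fe f] := @attach_inl k S void [::]; exact: pi_map f.
have [T' [E' [h' [aE' sE' subE' gE']]]] := attach_handle aE pg.
exists T', E', h'; split=> //.
- rewrite -(leq_add2r #|T|); apply: leq_trans sE' _.
  by apply: leq_trans (leq_add (leq_add sE (leqnn _)) (leqnn _)) _; rewrite /=; lia.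
- exact: subset_trans subE subE'.
- by constructor=> //; apply: List.Forall_impl sS.
Qed.

End Handles.

Section Chains.
Variables (k : nat) (F : groupType) (X : 'I_k -> F).
Hypothesis hX : free_basis X [set: F].
Implicit Types S Gam : pgraph k.

Lemma chain_leq S Gam (gv : vert S -> vert Gam) ge (s : seq F) :
  folded Gam -> core_like X S -> finite_edges S -> surjective_morphism gv ge ->
  List.Forall (pi X Gam) s ->
  (forall L, is_subgroup L -> pi X S `<=` L -> List.Forall L s -> pi X Gam `<=` L) ->
  exists2 m, (m <= size s)%N & chain X Gam S m.
Proof.
move=> fG cS finS g sG gen; have gb : gv base = base by case: g => -[].
have [T [E [h [aE sE subE sE']]]] := attach_handles gb sG.
have [|m [mE cm]] := attached_chain hX fG cS finS g aE.
  by apply: gen => //; exact: is_subgroup_pi.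
by exists m => //; rewrite -(leq_add2r #|T|); exact: leq_trans mE sE.
Qed.

Lemma quotient_chain_of_chain H J m :
  chain X (core_graph X J) (core_graph X H) m -> quotient_chain X H J m.
Proof.
suff main S : chain X (core_graph X J) S m -> exists G : nat -> pgraph k,
    [/\ G 0 = S, iso (G m) (core_graph X J),
    forall i, (i <= m)%N -> is_core_graph X (G i) &
    forall i, (i < m)%N -> immediate_quotient (G i) (G i.+1)].
  move=> /main[G [G0 Gm Gc Gi]]; exists G; split=> //.
  by rewrite G0; exact: iso_refl.
elim=> {m S} [S cS iS|S S' m cS iq _ [G [G0 Gm Gc Gi]]].
  exists (fun _ => S); split=> //.
  move=> i _; exact: (core_like_is_core_graph hX cS).
exists (fun i => if i is i'.+1 then G i' else S); split=> // [[|i] im|[|i] im].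
- exact: (core_like_is_core_graph hX cS).
- exact: Gc.
- by rewrite G0.
- exact: Gi.
Qed.

Lemma quotient_chain_gen H J m : is_subgroup H -> is_subgroup J ->
  quotient_chain X H J m -> exists z : 'I_m -> F,
    [/\ H `<=` J, forall i, J (z i) &
     forall L, is_subgroup L -> H `<=` L -> (forall i, L (z i)) -> J `<=` L].
Proof.
move=> sH sJ [G [G0 Gm Gc Gi]].
have /choice[z zP] : forall i, exists z : F, (i < m)%N ->
    [/\ pi X (G i) `<=` pi X (G i.+1), pi X (G i.+1) z &
      forall L, is_subgroup L -> pi X (G i) `<=` L -> L z -> pi X (G i.+1) `<=` L].
  move=> i; have [im|im] := boolP (i < m)%N; last by exists 1.
  have cG := is_core_graph_connected (Gc i (ltnW im)).
  by have [_ sub [z z1 z2]] := pi_immediate_quotient (Gi i im) cG; exists z.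
have sub i j : (i + j <= m)%N -> pi X (G i) `<=` pi X (G (i + j)%N).
  elim: j => [|j IH] ij; first by rewrite addn0.
  rewrite addnS; apply: subset_trans (IH _) _; first by lia.
  by have [] := zP (i + j)%N _; first by lia.
have HE : pi X (G 0) = H by rewrite (pi_iso X G0) pi_core_graph.
have JE : pi X (G m) = J by rewrite (pi_iso X Gm) pi_core_graph.
exists (fun i : 'I_m => z i); split.
- by rewrite -HE -JE -[m in G m]add0n; apply: sub.
- move=> i; have [_ zi _] := zP i (ltn_ord i).
  have := @sub i.+1 (m - i.+1)%N; rewrite subnKC // leqnn => /(_ isT)/(_ _ zi).
  by rewrite JE.
- move=> L sL HL zL; rewrite -JE.
  suff main i : (i <= m)%N -> pi X (G i) `<=` L by exact: main.
  elim: i => [_|i IH im]; first by rewrite HE.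
  have [_ _ gen] := zP i im; apply: gen => //; first by apply: IH; exact: ltnW.
  exact: (zL (Ordinal im)).
Qed.

End Chains.

(** * Free products and bases *)

Section FreeProducts.
Variable F : groupType.
Implicit Types (H K J : set F) (s : seq (bool * F)) (a : bool * F).

Definition syllable H K a := (if a.1 then H else K) a.2.
Definition syllables H K s := forall a, a \in s -> syllable H K a.
Definition syl_prod s := \prod_(a <- s) a.2.

Lemma syl_prod_cons a s : syl_prod (a :: s) = a.2 * syl_prod s.
Proof. by rewrite /syl_prod big_cons. Qed.

Lemma syl_prod_nil : syl_prod [::] = 1.
Proof. by rewrite /syl_prod big_nil. Qed.

Lemma syl_prod_cat s1 s2 : syl_prod (s1 ++ s2) = syl_prod s1 * syl_prod s2.
Proof. by rewrite /syl_prod big_cat. Qed.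

Lemma alternating_cons H K a s : alternating H K (a :: s) <->
  [/\ (if s is a' :: _ then a.1 != a'.1 else true), a.2 != 1, syllable H K a &
      alternating H K s].
Proof.
split=> [[srt al]|[h1 h2 h3 [srt al]]].
  have [a1 a2] := al a (mem_head _ _); split=> //.
    by case: s srt {al} => //= a' s /andP[].
  split=> [|x xs]; first exact: path_sorted srt.
  by apply: al; rewrite inE xs orbT.
split=> [|x]; first by case: s srt h1 {al} => //= a' s -> ->.
by rewrite inE => /predU1P[->|]; [split|exact: al].
Qed.

Lemma alternating_nil H K : alternating H K [::].
Proof. by split. Qed.

(** Syllables of the inverse of [s1] followed by [s2], in the manner of [catrev]. *)
Fixpoint inv_cat s1 s2 :=
  if s1 is a :: s1' then inv_cat s1' ((a.1, a.2^-1) :: s2) else s2.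

Lemma syl_prod_inv_cat s1 s2 :
  syl_prod (inv_cat s1 s2) = (syl_prod s1)^-1 * syl_prod s2.
Proof.
elim: s1 s2 => [|a s1 IH] s2 /=; first by rewrite syl_prod_nil invg1 mul1g.
by rewrite IH !syl_prod_cons invgM mulgA.
Qed.

Lemma size_inv_cat s1 s2 : size (inv_cat s1 s2) = (size s1 + size s2)%N.
Proof. by elim: s1 s2 => //= a s1 IH s2; rewrite IH addnS. Qed.

Lemma syllable_inv H K a : is_subgroup H -> is_subgroup K ->
  syllable H K a -> syllable H K (a.1, a.2^-1).
Proof.
by move=> [_ _ HV] [_ _ KV]; case: a => -[] x; [apply: HV|apply: KV].
Qed.

Lemma syllables_inv_cat H K s1 s2 : is_subgroup H -> is_subgroup K ->
  syllables H K s1 -> syllables H K s2 -> syllables H K (inv_cat s1 s2).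
Proof.
move=> sH sK; elim: s1 s2 => //= a s1 IH s2 h1 h2; apply: IH.
  by move=> x xs; apply: h1; rewrite inE xs orbT.
move=> x; rewrite inE => /predU1P[->|]; last exact: h2.
by apply: syllable_inv => //; apply: h1; exact: mem_head.
Qed.

Lemma alternating_inv_cat H K s1 s2 : is_subgroup H -> is_subgroup K ->
  alternating H K s1 -> alternating H K s2 ->
  (if s1 is a :: _ then if s2 is b :: _ then a.1 != b.1 else true else true) ->
  alternating H K (inv_cat s1 s2).
Proof.
move=> sH sK; elim: s1 s2 => //= a s1 IH s2 /alternating_cons[h1 h2 h3 h4] al2 h.
apply: IH => //; last by case: s1 h1 {h4} => //= d s1; rewrite eq_sym.
apply/alternating_cons; split=> //=; [by case: (s2) h|by rewrite invg_eq1|exact: syllable_inv].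
Qed.

Lemma alternating_of_syllables H K s : is_subgroup H -> is_subgroup K ->
  syllables H K s -> exists2 s', alternating H K s' & syl_prod s' = syl_prod s.
Proof.
move=> sH sK; elim: s => [|a s IH] sylS; first by exists [::].
have [|s' al pr] := IH; first by move=> x xs; apply: sylS; rewrite inE xs orbT.
have sa : syllable H K a by apply: sylS; exact: mem_head.
rewrite syl_prod_cons -pr; have [a1|a1] := eqVneq a.2 1.
  by exists s'; rewrite ?a1 ?mul1g.
case: s' al {pr} => [|a' s'] al.
  by exists [:: a]; rewrite ?syl_prod_cons //; apply/alternating_cons; split.
have [e|ne] := eqVneq a.1 a'.1; last first.
  by exists (a :: a' :: s'); rewrite ?syl_prod_cons //; apply/alternating_cons; split.
move/alternating_cons: al => [h1 h2 h3 h4]; rewrite syl_prod_cons mulgA.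
have [m1|m1] := eqVneq (a.2 * a'.2) 1; first by exists s'; rewrite ?m1 ?mul1g.
exists ((a'.1, a.2 * a'.2) :: s'); last by rewrite syl_prod_cons.
apply/alternating_cons; split=> //.
move: sa h3; rewrite /syllable e /=; case: sH sK => [_ HM _] [_ KM _].
by case: ifP => _; [exact: HM|exact: KM].
Qed.

(** As for bases, uniqueness of normal forms follows from the absence of relations. If the first
    syllables differ but lie in the same factor, they combine into one nontrivial syllable
    [a.2^-1 * b.2] between the two remainders. *)
Lemma free_product_intro H K J : is_subgroup H -> is_subgroup K -> is_subgroup J ->
  H `<=` J -> K `<=` J ->
  (forall x, J x -> exists2 s, syllables H K s & syl_prod s = x) ->
  (forall s, alternating H K s -> syl_prod s = 1 -> s = [::]) ->
  free_product H K J.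
Proof.
move=> sH sK [J1 JM JV] HJ KJ gen triv; split.
- move=> s; rewrite -/(syl_prod s) /=; elim: s => [|a s IH] /=.
    by rewrite syl_prod_nil.
  move/alternating_cons=> [_ _ h /IH]; rewrite syl_prod_cons; apply: JM.
  by move: h; rewrite /syllable; case: ifP => _; [exact: HJ|exact: KJ].
- move=> s1 s2 /set_mem al1 /set_mem al2; rewrite -/(syl_prod s1) -/(syl_prod s2).
  elim: s1 s2 al1 al2 => [|a s1 IH] [|b s2] al1 al2 //.
  + by rewrite syl_prod_nil => /esym/(triv _ al2).
  + by rewrite syl_prod_nil => /(triv _ al1).
  move=> e; have [ab|ab] := eqVneq a.1 b.1; last first.
    have /triv : alternating H K (inv_cat (a :: s1) (b :: s2)).
      exact: alternating_inv_cat.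
    rewrite syl_prod_inv_cat e mulVg => /(_ erefl)/(congr1 size).
    by rewrite size_inv_cat.
  move: al1 al2 e => /alternating_cons[a1 a2 a3 a4] /alternating_cons[b1 b2 b3 b4].
  rewrite !syl_prod_cons; have [ab2|ab2] := eqVneq a.2 b.2.
    rewrite ab2 => /mulgI/(IH _ a4 b4) ->.
    by case: (a) (b) ab ab2 => ? ? [? ?] /= -> ->.
  move=> e; have /triv : alternating H K (inv_cat s1 ((a.1, a.2^-1 * b.2) :: s2)).
    apply: alternating_inv_cat => //; last by case: (s1) a1 => //= d _; rewrite eq_sym.
    apply/alternating_cons; split=> /=; [by rewrite ab| |  |by []].
      by rewrite mulg_eq1 (inj_eq invg_inj) eq_sym eq_sym.
    move: a3 b3; rewrite /syllable -ab /=.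
    case: sH sK => [_ HM HV] [_ KM KV].
    by case: ifP => _ ? ?; [apply: HM => //; exact: HV|apply: KM => //; exact: KV].
  rewrite syl_prod_inv_cat syl_prod_cons /= -[_ * syl_prod s2]mulgA -e mulKg mulVg.
  by move=> /(_ erefl)/(congr1 size); rewrite size_inv_cat /= addnS.
- by move=> x /gen[s /(alternating_of_syllables sH sK)[s' al <-] <-]; exists s'.
Qed.

Lemma free_product_subl H K J : is_subgroup H -> free_product H K J -> H `<=` J.
Proof.
move=> [H1 HM HV] [im _ _] h Hh; have [->|h1] := eqVneq h 1.
  by have := im [::] (alternating_nil _ _); rewrite big_nil.
have := im [:: (true, h)]; rewrite big_seq1; apply; apply/alternating_cons.
by split=> //; exact: alternating_nil.
Qed.

(* If [J = H * K] is finitely generated and [K0] is generated by the syllables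
   in [K] of the generators of [J], then [J] is generated by [H] and [K0], and
   uniqueness of normal forms gives [K0 = K]. *)
Lemma free_product_fin_gen H K J : is_subgroup H -> is_subgroup K ->
  free_product H K J -> fin_gen J -> fin_gen K.
Proof.
move=> sH sK [im inj sur] [n [g Jg]].
have /choice[sg sgP] : forall i, exists s, alternating H K s /\ syl_prod s = g i.
  by move=> i; have [|s al e] := sur (g i); [rewrite Jg; exact: range_gen|exists s].
pose l := [seq a.2 | a <- flatten [seq sg i | i <- enum 'I_n] & ~~ a.1].
pose c := tnth (in_tuple l); exists (size l), c.
pose K0 := range (word_val c); have sK0 : is_subgroup K0 by exact: is_subgroup_range.
have K0K : K0 `<=` K.
  apply: range_sub => // i; rewrite /c; have := mem_tnth i (in_tuple l) => /mapP[a].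
  rewrite mem_filter => /andP[a1 /flatten_mapP[j _ aj]] ->.
  have [[_ al] _] := sgP j; have [_] := al a aj.
  by rewrite (negPf a1).
have sylg i : syllables H K0 (sg i).
  move=> a ai; have [[_ al] _] := sgP i; have [_] := al a ai.
  rewrite /syllable; case: ifP => // a1 _.
  have /tnthP[j ->] : a.2 \in in_tuple l.
    apply/mapP; exists a => //; rewrite mem_filter a1 /=.
    by apply/flatten_mapP; exists i => //; rewrite mem_enum.
  exact: range_gen.
pose L : set F := [set x | exists2 s, syllables H K0 s & syl_prod s = x].
have sL : is_subgroup L.
  split=> [|_ _ [s1 h1 <-] [s2 h2 <-]|_ [s h <-]].
  - by exists [::]; rewrite ?syl_prod_nil.
  - exists (s1 ++ s2); last exact: syl_prod_cat.
    by move=> a; rewrite mem_cat => /orP[]; [exact: h1|exact: h2].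
  - exists (inv_cat s [::]); first exact: syllables_inv_cat.
    by rewrite syl_prod_inv_cat syl_prod_nil mulg1.
have JL : J `<=` L.
  by rewrite Jg; apply: range_sub => // i; exists (sg i) => //; have [] := sgP i.
apply/seteqP; split=> // x Kx; have [->|x1] := eqVneq x 1; first by case: sK0.
have alx : alternating H K [:: (false, x)].
  by apply/alternating_cons; split=> //; exact: alternating_nil.
have Jx : J x by have := im _ alx; rewrite big_seq1.
have [s syl sx] := JL _ Jx.
have [s' al e] := alternating_of_syllables sH sK0 syl.
have al' : alternating H K s'.
  case: al => srt h; split=> // a /h[a1 a2]; split=> //.
  by move: a2; case: ifP => // _; exact: K0K.
(* [s'] is a normal form for [H] and [K] as well, so it is the one-syllable normal form of [x]. *)
have s'E : s' = [:: (false, x)].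
  apply: inj; [exact: mem_set|exact: mem_set|].
  by rewrite big_seq1 -/(syl_prod s') e sx.
have [_ h] := al; rewrite s'E in h.
by have [] := h (false, x) (mem_head _ _).
Qed.

(** * Free products and joined bases *)

Section Bases.
Variables n m : nat.
Implicit Types (b : 'I_n -> F) (c : 'I_m -> F).

Definition join_fam b c (i : 'I_(n + m)) : F :=
  match fintype.split i with inl j => b j | inr j => c j end.

Definition lword (w : seq ('I_n * bool)) : seq ('I_(n + m) * bool) :=
  [seq (lshift m l.1, l.2) | l <- w].
Definition rword (w : seq ('I_m * bool)) : seq ('I_(n + m) * bool) :=
  [seq (rshift n l.1, l.2) | l <- w].

(** True on letters of the first family, in agreement with the tags of syllables. *)
Definition side (l : 'I_(n + m) * bool) := (l.1 < n)%N.

Lemma join_lshift b c j : join_fam b c (lshift m j) = b j.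
Proof. by rewrite /join_fam (unsplitK (inl j)). Qed.

Lemma join_rshift b c j : join_fam b c (rshift n j) = c j.
Proof. by rewrite /join_fam (unsplitK (inr j)). Qed.

Lemma word_val_lword b c w : word_val (join_fam b c) (lword w) = word_val b w.
Proof.
elim: w => [|l w IH]; first by rewrite !word_val0.
by rewrite [lword _]/= !word_val_cons IH /letter_val /= join_lshift.
Qed.

Lemma word_val_rword b c w : word_val (join_fam b c) (rword w) = word_val c w.
Proof.
elim: w => [|l w IH]; first by rewrite !word_val0.
by rewrite [rword _]/= !word_val_cons IH /letter_val /= join_rshift.
Qed.

Lemma reduced_map p q (f : 'I_p -> 'I_q) w : injective f ->
  reduced_word [seq (f l.1, l.2) | l <- w] = reduced_word w.
Proof.
move=> fI; elim: w => // l w IH; rewrite /= !reduced_cons IH; congr (_ && _).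
case: w {IH} => //= l' w; rewrite /inv_letter /=.
by rewrite -!pair_eqE /= /pair_eq /= (inj_eq fI).
Qed.

Lemma reduced_lword w : reduced_word (lword w) = reduced_word w.
Proof. exact/reduced_map/lshift_inj. Qed.

Lemma reduced_rword w : reduced_word (rword w) = reduced_word w.
Proof. exact/reduced_map/rshift_inj. Qed.

Lemma side_lword w : all side (lword w).
Proof. by elim: w => //= l w ->; rewrite /side /= ltn_ord. Qed.

Lemma side_rword w : all (predC side) (rword w).
Proof. by elim: w => //= l w ->; rewrite /side /= -leqNgt leq_addr. Qed.

Lemma lwordP w : all side w -> exists u, w = lword u.
Proof.
elim: w => [|[i e] w IH] /=; first by exists [::].
move=> /andP[li /IH[u ->]]; exists ((Ordinal li, e) :: u) => /=.
by congr ((_, _) :: _); apply: val_inj.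
Qed.

Lemma rwordP w : all (predC side) w -> exists u, w = rword u.
Proof.
elim: w => [|[i e] w IH] /=; first by exists [::].
rewrite /side /= -leqNgt => /andP[li /IH[u ->]].
have lt : (i - n < m)%N by rewrite ltn_subLR.
exists ((Ordinal lt, e) :: u) => /=.
by congr ((_, _) :: _); apply: val_inj; rewrite /= subnKC.
Qed.

Lemma range_join b c (L : set F) : is_subgroup L ->
  range (word_val b) `<=` L -> range (word_val c) `<=` L ->
  range (word_val (join_fam b c)) `<=` L.
Proof.
move=> sL bL cL; apply: range_sub => // i; rewrite /join_fam.
by case: fintype.split => j; [apply: bL|apply: cL]; exact: range_gen.
Qed.

Lemma range_joinl b c : range (word_val b) `<=` range (word_val (join_fam b c)).
Proof. by move=> _ [w _ <-]; exists (lword w) => //; exact: word_val_lword. Qed.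

Lemma range_joinr b c : range (word_val c) `<=` range (word_val (join_fam b c)).
Proof. by move=> _ [w _ <-]; exists (rword w) => //; exact: word_val_rword. Qed.

(** Each syllable is replaced by a nonempty reduced word in its own family; neighbouring words use
    different generators, so the concatenation is reduced. The induction keeps track of the side of
    the first letter. *)
Lemma free_product_of_basis b c J : free_basis (join_fam b c) J ->
  free_product (range (word_val b)) (range (word_val c)) J.
Proof.
move=> /free_basisP[-> triv]; set H := range (word_val b); set K := range (word_val c).
have sH : is_subgroup H by exact: is_subgroup_range.
have sK : is_subgroup K by exact: is_subgroup_range.
apply: free_product_intro => //.
- exact: is_subgroup_range.
- exact: range_joinl.
- exact: range_joinr.
- pose L : set F := [set x | exists2 s, syllables H K s & syl_prod s = x].
  have sL : is_subgroup L.
    split=> [|_ _ [s1 h1 <-] [s2 h2 <-]|_ [s h <-]].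
    - by exists [::]; rewrite ?syl_prod_nil.
    - exists (s1 ++ s2); last exact: syl_prod_cat.
      by move=> a; rewrite mem_cat => /orP[]; [exact: h1|exact: h2].
    - exists (inv_cat s [::]); first exact: syllables_inv_cat.
      by rewrite syl_prod_inv_cat syl_prod_nil mulg1.
  apply: (range_join sL) => x hx.
    by exists [:: (true, x)]; rewrite ?syl_prod_cons ?syl_prod_nil ?mulg1 // => a;
      rewrite inE => /eqP ->.
  by exists [:: (false, x)]; rewrite ?syl_prod_cons ?syl_prod_nil ?mulg1 // => a;
    rewrite inE => /eqP ->.
move=> s al s1.
suff [w [rw wv ws]] : exists w, [/\ reduced_word w,
    word_val (join_fam b c) w = syl_prod s &
    match s with
    | a :: _ => if w is l :: _ then side l = a.1 else False
    | [::] => w = [::] end].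
  have w0 : w = [::] by apply: triv; rewrite // wv.
  by rewrite w0 in ws; case: (s) ws.
elim: s al {s1} => [|a s IH]; first by exists [::]; rewrite word_val0 syl_prod_nil.
move/alternating_cons=> [h1 h2 h3 /IH[w [rw wv ws]]].
have [u [ru uv us u0]] : exists u, [/\ reduced_word u,
    word_val (join_fam b c) u = a.2, all (fun l => side l == a.1) u & u <> [::]].
  move: h3; rewrite /syllable; case: ifP => a1 [u _ ua].
    exists (lword (reduce u)); rewrite reduced_lword reduced_reduce.
    rewrite word_val_lword word_val_reduce ua; split=> //.
      by apply: sub_all (side_lword _) => l /= ->.
    move=> u0; move: h2; rewrite -ua -word_val_reduce -(word_val_lword b c).
    by rewrite u0 word_val0 eqxx.
  exists (rword (reduce u)); rewrite reduced_rword reduced_reduce.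
  rewrite word_val_rword word_val_reduce ua; split=> //.
    by apply: sub_all (side_rword _) => l /= /negPf ->.
  move=> u0; move: h2; rewrite -ua -word_val_reduce -(word_val_rword b c).
  by rewrite u0 word_val0 eqxx.
exists (u ++ w); split.
- apply: reduced_cat => // u1 l l' w2 uE wE; apply/eqP => ll'.
  move: us; rewrite uE all_rcons => /andP[/eqP sl _].
  move: h1 ws; rewrite wE; case: (s) => // a' s' h1.
  by rewrite ll' (_ : side (inv_letter l) = side l) // sl => e; rewrite e eqxx in h1.
- by rewrite word_val_cat uv wv syl_prod_cons.
- by case: (u) us u0 => //= l u' /andP[/eqP ->].
Qed.

(** A reduced word splits into maximal one-sided blocks. Each block is a nonempty reduced word in a
    basis, so its value is a nontrivial syllable; a word of value 1 thus has no blocks. *)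
Lemma basis_of_free_product b c H K J : is_subgroup J -> is_subgroup H ->
  K `<=` J -> free_basis b H -> free_basis c K -> free_product H K J ->
  free_basis (join_fam b c) J.
Proof.
move=> sJ sH KJ /free_basisP[HE bT] /free_basisP[KE cT] fp.
have HJ := free_product_subl sH fp; have [im inj sur] := fp.
apply/free_basisP; split.
  apply/seteqP; split; last by apply: range_join; rewrite -?HE -?KE.
  move=> x /sur[s [_ al] <-]; have [L1 LM _] := is_subgroup_range (join_fam b c).
  elim: s al => [|a s IH] al; first by rewrite big_nil.
  rewrite big_cons; apply: LM; last first.
    by apply: IH => y ys; apply: al; rewrite inE ys orbT.
  have [_] := al a (mem_head _ _); case: ifP => _; rewrite ?HE ?KE.
    exact: range_joinl.
  exact: range_joinr.
move=> w rw w1.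
suff [s [al sv sw]] : exists s, [/\ alternating H K s,
    syl_prod s = word_val (join_fam b c) w &
    match w with
    | l :: _ => if s is a :: _ then side l = a.1 else False
    | [::] => s = [::] end].
  have s0 : s = [::].
    apply: inj; [exact: mem_set|exact/mem_set/alternating_nil|].
    by rewrite -/(syl_prod s) sv w1 big_nil.
  by rewrite s0 in sw; case: (w) sw.
have [p] := ubnP (size w); elim: p w rw {w1} => // p IH [|l w] rw sw.
  by exists [::]; rewrite word_val0 syl_prod_nil; split=> //; exact: alternating_nil.
(* [l :: u] is the first maximal block, and [v] starts on the other side. *)
have [u [v [uv us vs]]] : exists u v, [/\ w = u ++ v, all (fun l' => side l' == side l) u &
    if v is l' :: _ then side l' != side l else true].
  elim: (w) => [|l' w' [u [v [-> us vs]]]]; first by exists [::], [::].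
  have [e|ne] := eqVneq (side l') (side l).
    by exists (l' :: u), v; rewrite /= e eqxx.
  by exists [::], (l' :: u ++ v).
have /andP[ru rv] : reduced_word (l :: u) && reduced_word v.
  move: rw; rewrite uv -cat_cons; elim: (l :: u) => //= l1 u1 IH1.
  rewrite !reduced_cons => /andP[h /IH1/andP[-> ->]].
  by case: u1 h {IH1} => [|l2 u1] /=; rewrite ?andbT // => ->.
have [s [al sv ss]] : exists s, [/\ alternating H K s,
    syl_prod s = word_val (join_fam b c) v &
    match v with
    | l :: _ => if s is a :: _ then side l = a.1 else False
    | [::] => s = [::] end].
  apply: IH => //; move: sw; rewrite uv /= size_cat ltnS; apply: leq_ltn_trans.
  exact: leq_addl.
have [x1 x2] : word_val (join_fam b c) (l :: u) != 1 /\
    syllable H K (side l, word_val (join_fam b c) (l :: u)).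
  have {}us : all (fun l' => side l' == side l) (l :: u) by rewrite /= eqxx.
  rewrite /syllable /=; case: ifP us => sl us.
    have [|u' u'E] := @lwordP (l :: u); first by apply: sub_all us => l' /eqP.
    rewrite u'E reduced_lword in ru *; rewrite word_val_lword HE; split; last by exists u'.
    by apply/eqP => /(bT _ ru) u'0; rewrite u'0 in u'E.
  have [|u' u'E] := @rwordP (l :: u); first by apply: sub_all us => l' /= /eqP ->.
  rewrite u'E reduced_rword in ru *; rewrite word_val_rword KE; split; last by exists u'.
  by apply/eqP => /(cT _ ru) u'0; rewrite u'0 in u'E.
exists ((side l, word_val (join_fam b c) (l :: u)) :: s); split=> //.
  apply/alternating_cons; split=> //.
  by case: (v) vs ss => [_ ->//|l' v' ne]; case: (s) => // a s' <-; rewrite eq_sym.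
by rewrite syl_prod_cons sv uv -cat_cons word_val_cat.
Qed.

End Bases.
End FreeProducts.

(** * Free factors *)

Section MainTheorem.
Variables (k : nat) (F : groupType) (X : 'I_k -> F).
Hypothesis hX : free_basis X [set: F].
Implicit Types H J : set F.

Lemma subgroup_basis H : is_subgroup H -> fin_gen H ->
  exists n (b : 'I_n -> F), free_basis b H.
Proof.
move=> sH fH; have [fG cG _] := core_like_core_graph X H.
have := nielsen_schreier hX (finite_core_graph hX sH fH) fG cG.
by rewrite pi_core_graph.
Qed.

Lemma quotient_chain_join H J m n (b : 'I_n -> F) : is_subgroup H -> is_subgroup J ->
  H = range (word_val b) -> quotient_chain X H J m ->
  exists z : 'I_m -> F, J = range (word_val (join_fam b z)).
Proof.
move=> sH sJ HE /(quotient_chain_gen hX sH sJ)[z [HJ Jz gen]]; exists z.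
apply/seteqP; split.
  apply: gen; [exact: is_subgroup_range|by rewrite HE; exact: range_joinl|].
  by move=> i; apply: range_joinr; exact: range_gen.
by apply: range_join => //; [rewrite -HE|exact: range_sub].
Qed.

Lemma join_quotient_chain H J n s (b : 'I_n -> F) (c : 'I_s -> F) :
  is_subgroup H -> is_subgroup J -> fin_gen H ->
  is_quotient (core_graph X H) (core_graph X J) ->
  H = range (word_val b) -> J = range (word_val (join_fam b c)) ->
  exists2 m, (m <= s)%N & quotient_chain X H J m.
Proof.
move=> sH sJ fH [fv [fe f]] HE JE; have [fJ _ _] := core_like_core_graph X J.
have cJ i : J (c i) by rewrite JE; apply: range_joinr; exact: range_gen.
have := chain_leq hX (s := [seq c i | i <- enum 'I_s]) fJ
  (core_like_core_graph X H) (finite_core_graph hX sH fH) f.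
rewrite !pi_core_graph // size_map size_enum_ord => -[||m ms ch].
- by apply/List.Forall_map/List.Forall_forall.
- move=> L sL HL /List.Forall_map/List.Forall_forall cL.
  rewrite JE; apply: range_join => //; first by rewrite -HE.
  by apply: range_sub => // i; apply: cL; apply/In_mem; rewrite mem_enum.
- by exists m => //; exact: quotient_chain_of_chain.
Qed.

(** As soon as some chain exists, a shortest one does, and [rho] does not take its default value. *)
Lemma rho_min H J m : quotient_chain X H J m ->
  quotient_chain X H J (rho X H J) /\
  forall m', quotient_chain X H J m' -> (rho X H J <= m')%N.
Proof.
move=> ch; rewrite /rho; case: xgetP => [_ -> //|none].
have ex : exists m, `[< quotient_chain X H J m >] by exists m; apply/asboolP.
case: (ex_minnP ex) => r /asboolP rP rmin; case: (none r); split=> // m' /asboolP.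
exact: rmin.
Qed.

End MainTheorem.

Local Open Scope ring_scope.

Theorem theorem1p1 (k : nat) (hk : (1 <= k)%N)
    (F : groupType) (X : 'I_k -> F) (hX : free_basis X [set: F])
    (H J : set F)
    (hH : is_subgroup H) (hJ : is_subgroup J)
    (hHfg : fin_gen H) (hJfg : fin_gen J)
    (hq : is_quotient (core_graph X H) (core_graph X J)) :
  free_factor H J <-> (rho X H J)%:Z = (rk J)%:Z - (rk H)%:Z.
Proof.
have [n [b bH]] := subgroup_basis hX hH hHfg; rewrite (rk_basis bH).
have [HE _] := (free_basisP _ _).1 bH.
have [r [a aJ]] := subgroup_basis hX hJ hJfg; rewrite (rk_basis aJ).
split=> [[K [sK KJ fp]]|rhoE].
  have fK := free_product_fin_gen hH sK fp hJfg.
  have [s [c cK]] := subgroup_basis hX sK fK.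
  have jJ := basis_of_free_product hJ hH KJ bH cK fp.
  have rE := basis_size aJ jJ; have [JE _] := (free_basisP _ _).1 jJ.
  have [m ms ch] := join_quotient_chain hX hH hJ hHfg hq HE JE.
  have [chr rmin] := rho_min ch; have rm := rmin _ ch.
  (* Here [rho X H J <= m <= s], while [J] is generated by [n + rho X H J] elements, which cannot be
     fewer than its rank [n + s]. *)
  have [z zE] := quotient_chain_join hX hH hJ HE chr.
  have := basis_leq aJ zE; lia.
have HJ : H `<=` J.
  have [fv [fe [f _ _]]] := hq; have := pi_map (X := X) f.
  by rewrite !pi_core_graph.
have [t [g JE]] := hJfg.
(* Adjoining any finite generating family of [J] to the basis of [H] produces some chain, so
   [rho X H J] is the length of a chain and not the default 0. *)
have JEj : J = range (word_val (join_fam b g)).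
  apply/seteqP; split; first by rewrite {1}JE; exact: range_joinr.
  by apply: range_join; rewrite -?HE -?JE.
have [m _ ch] := join_quotient_chain hX hH hJ hHfg hq HE JEj.
have [chr _] := rho_min ch.
have [z zE] := quotient_chain_join hX hH hJ HE chr.
(* The integer equality gives [n <= r]; now [b] and [z] together generate [J] and have exactly [r]
   members. *)
have rE : (r = n + rho X H J)%N by lia.
rewrite {}rE in a aJ; exists (range (word_val z)); split.
- exact: is_subgroup_range.
- have /seteqP[_ zJ] := zE; exact: subset_trans (@range_joinr _ _ _ b z) zJ.
- by have := free_product_of_basis (generating_basis aJ zE); rewrite -HE.
Qed.
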